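(* Let $(\mathcal A,\varphi)$ be a higher order probability space and consider subsets $(\mathcal X_i)_{i\in I}$ of $\mathcal A$. For each $i\in I$, let $\mathcal A_i$ be the unital subalgebra of $\mathcal A$ generated by the elements of $\mathcal X_i$. Then the following are equivalent: (1) the subsets $(\mathcal X_i)_{i\in I}$ are free of all orders; (2) the subalgebras $(\mathcal A_i)_{i\in I}$ are free of all orders.
   Context: Partitioned permutations: permutations are composed right to left; $\mathcal P(n)$ is the lattice of partitions of $[1,n]$ ordered by refinement ($\mathcal V\le\mathcal W$ iff each block of $\mathcal V$ lies in a block of $\mathcal W$), $\vee$ the join, $1_n$ the one-block partition; for $\pi\in S_n$, $|\pi|=n-\#\{\text{cycles of }\pi\}$, and $0_\pi$ is the partition into cycles; $|\mathcal V|=n-\#\mathcal V$. $\mathcal{PS}(n)$ is the set of pairs $(\mathcal V,\pi)$ with $\pi\in S_n$, $\mathcal V\in\mathcal P(n)$, $\mathcal V\ge0_\pi$; $\mathcal{PS}=\bigcup_n\mathcal{PS}(n)$; $|(\mathcal V,\pi)|=2|\mathcal V|-|\pi|$; $(\mathcal V,\pi)\cdot(\mathcal W,\sigma)=(\mathcal V\vee\mathcal W,\pi\sigma)$ if $|(\mathcal V,\pi)|+|(\mathcal W,\sigma)|=|(\mathcal V\vee\mathcal W,\pi\sigma)|$, and $0$ otherwise. Convolution of functions on $\mathcal{PS}$: $(f*g)(\mathcal U,\gamma)=\sum_{(\mathcal V,\pi)\cdot(\mathcal W,\sigma)=(\mathcal U,\gamma)}f(\mathcal V,\pi)g(\mathcal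 W,\sigma)$. $\zeta(\mathcal V,\pi)=1$ if $\mathcal V=0_\pi$, else $0$; $\delta(\mathcal V,\pi)=1$ if $\pi$ is the identity and $\mathcal V$ is the partition into singletons, else $0$; $\mu$ is the inverse: $\zeta*\mu=\delta=\mu*\zeta$. A higher order probability space (HOPS) $(\mathcal A,\varphi)$ is a unital complex algebra $\mathcal A$ with maps $\varphi_n:\mathcal A^n\to\mathbb C$ ($n\in\mathbb N$) that are linear and tracial in each argument, symmetric in the $n$ arguments, with $\varphi_1(1)=1$ and $\varphi_n(1,a_2,\dots,a_n)=0$ for $n\ge2$. Set $\varphi(1_n,\pi)[a_1,\dots,a_n]=\varphi_r(a|_{c_1},\dots,a|_{c_r})$, where $c_1,\dots,c_r$ are the cycles of $\pi$ and $a|_c=a_{i_1}\cdots a_{i_k}$ for $c=(i_1,\dots,i_k)$, and $\varphi(\mathcal V,\pi)[a_1,\dots,a_n]=\prod_{V\in\mathcal V}\varphi(1_V,\pi|_V)[(a_i)_{i\in V}]$. The free cumulants are $\kappa(\mathcal U,\gamma)[a_1,\dots,a_n]=\sum_{(\mathcal V,\pi)\cdot(\mathcal W,\sigma)=(\mathcal U,\gamma)}\varphi(\mathcal V,\pi)[a_1,\dots,a_n]\,\mu(\mathcal W,\sigma)$. Subsets $(\mathcal X_i)_{i\in I}$ of $\mathcal A$ are free of all orders if $\kappa(1_n,\pi)[a_1,\dots,a_n]=0$ for all $n\ge2$, all $\pi\in S_n$ and all $a_k\in\mathcal X_{i(k)}$ ($1\le k\le n$) such that $i(p)\ne i(q)$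 for some $1\le p,q\le n$. *)

(* Defs.v *)
From HB Require Import structures.
From mathcomp Require Import boolp classical_sets reals complex.
(* Last, so that [set0], [subsetP], etc. refer to finite sets. *)
From mathcomp Require Import all_boot all_order all_algebra all_fingroup.

Set Implicit Arguments.
Unset Strict Implicit.
Unset Printing Implicit Defensive.

Import GRing.Theory.
Local Open Scope ring_scope.

(** * Set partitions of a finite type *)
Section SetPartitions.
Variable T : finType.
Implicit Types (V W U : {set {set T}}) (B C : {set T}).

Definition refines V W : bool := [forall B in V, exists C in W, B \subset C].

Definition same_block V W : rel T :=
  [rel x y | [exists B in V :|: W, (x \in B) && (y \in B)]].

(* The join is the partition into classes of the equivalence relation generated
   by lying in a common block of [V] or of [W]; the four lemmas below say that
   it is the least upper bound for refinement. *)
Definition pjoin V W : {set {set T}} :=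
  equivalence_partition (connect (same_block V W)) [set: T].

(* Removing [set0] is only relevant when [T] is empty. *)
Definition top_part : {set {set T}} := [set [set: T]] :\ set0.

Lemma connect_same_block_equiv V W :
  {in [set: T] & &, equivalence_rel (connect (same_block V W))}.
Proof.
have sym: connect_sym (same_block V W).
  apply: sym_connect_sym => x y /=.
  by apply: eq_existsb => B; rewrite [(x \in B) && _]andbC.
by move=> x y z _ _ _; split=> // xy; apply: same_connect.
Qed.

Lemma pjoin_partition V W : partition (pjoin V W) [set: T].
Proof. exact/equivalence_partitionP/connect_same_block_equiv. Qed.

Lemma refines_pjoin_sub V W B :
  B \in V :|: W -> B != set0 -> exists2 C, C \in pjoin V W & B \subset C.
Proof.
move=> BVW /set0Pn[x xB].
exists [set y in [set: T] | connect (same_block V W) x y].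
  by apply/imsetP; exists x.
apply/subsetP=> y yB; rewrite !inE; apply: connect1 => /=.
by apply/existsP; exists B; rewrite BVW xB.
Qed.

Lemma refines_pjoinl V W : partition V [set: T] -> refines V (pjoin V W).
Proof.
case/and3P=> _ _ V0; apply/forall_inP=> B BV; apply/exists_inP.
apply: refines_pjoin_sub; first by rewrite inE BV.
by apply: contraNneq V0 => <-.
Qed.

Lemma refines_pjoinr V W : partition W [set: T] -> refines W (pjoin V W).
Proof.
case/and3P=> _ _ W0; apply/forall_inP=> B BW; apply/exists_inP.
apply: refines_pjoin_sub; first by rewrite inE BW orbT.
by apply: contraNneq W0 => <-.
Qed.

Lemma pjoin_least V W U : partition U [set: T] ->
  refines V U -> refines W U -> refines (pjoin V W) U.
Proof.
move=> Upart VU WU; apply/forall_inP=> _ /imsetP[x _ ->].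
have [/eqP Ucov Utriv _] := and3P Upart.
have inU z : z \in cover U by rewrite Ucov inE.
apply/exists_inP; exists (pblock U x); first by rewrite pblock_mem.
apply/subsetP=> y; rewrite !inE /= => /connectP[p pth ->].
elim: p x pth => [|z p IHp] x /=; first by rewrite mem_pblock.
case/andP=> /existsP[B /and3P[BVW xB zB]] /IHp.
have [C CU sBC] : exists2 C, C \in U & B \subset C.
  move: BVW; rewrite inE => /orP[BV|BW]; apply/exists_inP.
    exact: (forall_inP VU).
  exact: (forall_inP WU).
by rewrite (def_pblock Utriv CU (subsetP sBC _ xB))
           (def_pblock Utriv CU (subsetP sBC _ zB)).
Qed.

Lemma top_part_partition : partition top_part [set: T].
Proof.
rewrite /partition /top_part !inE eqxx /= andbT; apply/andP; split.
  rewrite /cover eqEsubset subsetT /=; apply/subsetP=> x _.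
  apply/bigcupP; exists [set: T]; rewrite ?inE ?eqxx ?andbT //.
  by apply/set0Pn; exists x; rewrite inE.
by apply/trivIsetP=> A B; rewrite !inE => /andP[_ /eqP->] /andP[_ /eqP->] /eqP.
Qed.

Lemma refines_top V : partition V [set: T] -> refines V top_part.
Proof.
case/and3P=> _ _ V0; apply/forall_inP=> B BV; apply/exists_inP.
exists [set: T]; last exact: subsetT.
rewrite !inE eqxx andbT; apply: contraNneq V0 => T0.
suff -> : set0 = B by [].
by apply/esym/eqP; rewrite -subset0 -T0 subsetT.
Qed.

Lemma porbits_partition (s : {perm T}) : partition (porbits s) [set: T].
Proof.
apply/and3P; split.
- rewrite /cover eqEsubset subsetT /=; apply/subsetP=> x _.
  by apply/bigcupP; exists (porbit s x); rewrite ?imset_f ?porbit_id.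
- apply/trivIsetP=> _ _ /imsetP[x _ ->] /imsetP[y _ ->] nxy.
  rewrite -setI_eq0; apply: contraNT nxy => /set0Pn[z /setIP[zx zy]].
  by move: zx zy; rewrite -!eq_porbit_mem => /eqP <- /eqP <-.
by apply/imsetP=> -[x _ /setP/(_ x)]; rewrite inE porbit_id.
Qed.

End SetPartitions.

(** * Partitioned permutations *)

Definition is_partperm (T : finType) (u : {set {set T}} * {perm T}) : bool :=
  partition u.1 [set: T] && refines (porbits u.2) u.1.

Definition partperm (T : finType) :=
  {u : {set {set T}} * {perm T} | is_partperm u}.

HB.instance Definition _ (T : finType) := Finite.on (partperm T).

Section PartitionedPermutations.
Variable T : finType.
Implicit Types (u v w : partperm T).

Definition pp_part u : {set {set T}} := (val u).1.
Definition pp_perm u : {perm T} := (val u).2.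

Definition part_len (V : {set {set T}}) : nat := (#|T| - #|V|)%N.
Definition perm_len (s : {perm T}) : nat := (#|T| - #|porbits s|)%N.

(* No truncation occurs: [#|V| <= #|porbits s|] for a partitioned permutation
   [(V, s)]. *)
Definition pp_len u : nat :=
  (2 * part_len (pp_part u) - perm_len (pp_perm u))%N.

Lemma top_is_partperm (s : {perm T}) : is_partperm (top_part T, s).
Proof.
by rewrite /is_partperm /= top_part_partition refines_top ?porbits_partition.
Qed.

Definition pp_top (s : {perm T}) : partperm T := Sub _ (top_is_partperm s).

(* Permutations compose from right to left, whereas [(s * t)%g] applies [s]
   first: the product of [pi] and [sigma] is [(sigma * pi)%g]. *)
Lemma mul_is_partperm u v :
  is_partperm (pjoin (pp_part u) (pp_part v), (pp_perm v * pp_perm u)%g).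
Proof.
case: u v => -[V p] /= Hu [[W q]] /= Hv; rewrite /pp_part /pp_perm /=.
have [/andP[Vp pV] /andP[Wq qW]] := (Hu, Hv); rewrite /= in Vp pV Wq qW.
rewrite /is_partperm /= pjoin_partition /=.
apply/forall_inP=> _ /imsetP[x _ ->]; apply/exists_inP.
exists [set y in [set: T] | connect (same_block V W) x y].
  by apply/imsetP; exists x.
have step (s : {perm T}) (U : {set {set T}}) (z : T) : U \subset V :|: W -> refines (porbits s) U ->
    connect (same_block V W) z (s z).
  have sz : porbit s z \in porbits s by rewrite imset_f.
  move=> sU /forall_inP/(_ _ sz).
  case/exists_inP=> B BU /subsetP sB; apply: connect1 => /=; apply/existsP.
  by exists B; rewrite (subsetP sU) // !sB ?porbit_id // (mem_porbit s 1 z).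
apply/subsetP=> _ /porbitP[i ->]; rewrite !inE /=.
elim: i => [|i IHi]; first by rewrite expg0 perm1.
rewrite expgSr !permM; apply: connect_trans IHi _.
by apply: connect_trans (step q W _ (subsetUr _ _) qW)
  (step p V _ (subsetUl _ _) pV).
Qed.

(* [None] stands for the product [0]. *)
Definition pp_mul u v : option (partperm T) :=
  let w : partperm T := Sub _ (mul_is_partperm u v) in
  if pp_len u + pp_len v == pp_len w then Some w else None.

End PartitionedPermutations.

(** * Convolution *)

(* The convolution only relates values on a common index set, so a function on
   the union of the [PS(n)] is treated one index set at a time. *)
Section Convolution.
Variables (K : nzRingType) (T : finType).
Implicit Types f g : {ffun partperm T -> K}.

Definition conv f g : {ffun partperm T -> K} :=
  [ffun u => \sum_(p : partperm T * partperm T | pp_mul p.1 p.2 == Some u)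
               f p.1 * g p.2].

Definition pp_zeta : {ffun partperm T -> K} :=
  [ffun u => if pp_part u == porbits (pp_perm u) then 1 else 0].

Definition pp_delta : {ffun partperm T -> K} :=
  [ffun u => if (pp_perm u == 1%g) && (pp_part u == [set [set x] | x in T])
             then 1 else 0].

Definition conv_inverse f g : Prop :=
  conv f g = pp_delta /\ conv g f = pp_delta.

(* The convolution inverse of [pp_zeta]; the default value [0] is irrelevant
   since [pp_zeta] is invertible. *)
Definition pp_mu : {ffun partperm T -> K} :=
  xget 0 (conv_inverse pp_zeta : set {ffun partperm T -> K}).

End Convolution.

Arguments pp_zeta {K T}.
Arguments pp_delta {K T}.
Arguments pp_mu {K T}.

(** * Higher order probability spaces *)

Section HOPS.
Variables (R : realType) (A : algType R[i]).

(* The maps [phi_n], [n >= 1], are encoded by one function [phi] on finite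
   sequences, [phi_n] being its restriction to sequences of size [n]. The value
   [phi [::]] plays no role. *)
Record is_hops (phi : seq A -> R[i]) : Prop := IsHOPS {
  hops_linear : forall (s t : seq A) (c : R[i]) (x y : A),
    phi (s ++ (c *: x + y) :: t) = c * phi (s ++ x :: t) + phi (s ++ y :: t);
  hops_tracial : forall (s t : seq A) (x y : A),
    phi (s ++ (x * y) :: t) = phi (s ++ (y * x) :: t);
  hops_symmetric : forall s t : seq A, perm_eq s t -> phi s = phi t;
  hops_unit : phi [:: 1] = 1;
  hops_unit_cumul : forall s : seq A, (0 < size s)%N -> phi (1 :: s) = 0
}.

Variable phi : seq A -> R[i].

Section Moments.
Variables (T : finType) (a : T -> A).

(* [a_{i_1} ... a_{i_k}] for the cycle [c = (i_1, ..., i_k)] of [s], where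
   [i_{j+1} = s i_j]; by traciality the choice of [i_1] in [c] is irrelevant
   once [phi] is applied. *)
Definition cycle_prod (s : {perm T}) (c : {set T}) : A :=
  if [pick x in c] is Some x then \prod_(k < #|c|) a ((s ^+ k)%g x) else 1.

(* [phi (1_V, s|_V)] applied to [(a_i)_{i in V}]: the cycles of [s|_V] are the
   cycles of [s] contained in [V]. By symmetry their order is irrelevant. *)
Definition block_moment (s : {perm T}) (V : {set T}) : R[i] :=
  phi [seq cycle_prod s c | c <- enum [set c in porbits s | c \subset V]].

Definition moment : {ffun partperm T -> R[i]} :=
  [ffun u => \prod_(V in pp_part u) block_moment (pp_perm u) V].

Definition free_cumulant : {ffun partperm T -> R[i]} := conv moment pp_mu.

End Moments.

Definition free_of_all_orders (I : Type) (X : I -> set A) : Prop :=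
  forall (n : nat) (s : 'S_n) (i : 'I_n -> I) (a : 'I_n -> A),
    (2 <= n)%N ->
    (forall k, X (i k) (a k)) ->
    (exists p q, i p <> i q) ->
    free_cumulant a (pp_top s) = 0.

End HOPS.

Definition gen_subalgebra (R : realType) (A : algType R[i]) (X : set A) :
    set A :=
  smallest (fun S : set A => GRing.subalg_closed (mem S)) X.

(* Main.v *)
(* By linearity it suffices to treat cumulants whose entries are words in the
   generators, and words are shortened one letter at a time. If [a q] is the
   product of [a' None] and [a' (Some q)] for [a'] indexed by [option T], then

     kappa(u)[a] = sum_k sum_(v . (None k) = split_pt q u) kappa(v)[a'],

   because [zeta] factors as [zeta_star * zeta_fix], where [zeta_star] is
   supported by the transpositions [(None k)] and [zeta_fix] by the permutations
   fixing [None], and convolving both sides with [zeta] on [T] gives the moments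
   of [a]. When [u] is the full partition, a [v] in the sum with monochromatic
   blocks would force all colours to be equal; hence [v] has a block with two
   colours, and the multiplicativity of cumulants over blocks gives induction on
   the total length. Empty words are handled by the vanishing of higher order
   cumulants with an entry [1]. The triangle inequality for [pp_len], from the
   genus bound for two permutations, makes the partial product associative. *)
From HB Require Import structures.
Require Import Defs.
From mathcomp Require Import boolp classical_sets reals complex.
From mathcomp Require Import all_boot all_order all_algebra all_fingroup.
From mathcomp Require Import zify.

Set Implicit Arguments.
Unset Strict Implicit.
Unset Printing Implicit Defensive.

Import GRing.Theory.
Local Open Scope ring_scope.

(** * Set partitions *)

(* No value of [pp_mu] is ever computed. Identities between cumulants are checked on moments, where
   they are statements about cycles, and are carried back by cancelling [pp_zeta]; this is what
   associativity is for. Freeness speaks of ['I_n] only, but splitting a point and cutting out a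
   block both leave that family of index sets. Hence everything is stated over arbitrary finite
   types, and an enumeration enters only when all entries are single letters. Peeling off one letter
   at a time keeps the correction factor supported on transpositions: a single transposition can
   join blocks of [v] only at [None] and one other point, and the colours of these two are under
   control because the new point inherits the colour of [q]. *)
#[local] Hint Resolve pjoin_partition porbits_partition : core.

(* Locked because [done] would otherwise try to compute it. *)
HB.lock Definition peq (T : finType) (V : {set {set T}}) (x y : T) : bool :=
  pblock V x == pblock V y.

HB.lock Definition npts (T : finType) : nat := #|T|.
Lemma nptsE (T : finType) : npts T = #|T|. Proof. by rewrite npts.unlock. Qed.

HB.lock Definition nblk (T : finType) (V : {set {set T}}) : nat := #|V|.

Section Partitions.
Variable T : finType.
Implicit Types (V W U : {set {set T}}) (x y : T).

(** Refinement in pointwise form, so that joins can be compared without handling blocks; [refinesP]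
    links it to [refines]. *)
Definition pleq V W := forall x y, peq V x y -> peq W x y.
Definition kpart (rT : eqType) (g : T -> rT) := preim_partition g [set: T].

Lemma nblkE V : nblk V = #|V|. Proof. by rewrite nblk.unlock. Qed.

Lemma peqE V x y : peq V x y = (pblock V x == pblock V y).
Proof. by rewrite peq.unlock. Qed.

Lemma peq_mem V x y : partition V [set: T] -> peq V x y = (y \in pblock V x).
Proof.
by case/and3P=> /eqP cV tV _; rewrite peqE eq_pblock // cV inE.
Qed.

Lemma pblock_in V x : partition V [set: T] -> pblock V x \in V.
Proof. by case/and3P=> /eqP cV _ _; rewrite pblock_mem // cV inE. Qed.

Lemma pblock_id V x : partition V [set: T] -> x \in pblock V x.
Proof. by case/and3P=> /eqP cV _ _; rewrite mem_pblock cV inE. Qed.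

Lemma in_partP V B : partition V [set: T] -> B \in V ->
  exists x, B = pblock V x.
Proof.
move=> pV BV; have [_ tV n0] := and3P pV.
have /set0Pn[x xB] : B != set0 by apply: contraNneq n0 => <-.
by exists x; rewrite (def_pblock tV BV xB).
Qed.

Lemma part_image V : partition V [set: T] -> V = pblock V @: [set: T].
Proof.
move=> pV; apply/setP=> B; apply/idP/imsetP => [/(in_partP pV)[x ->]|[x _ ->]].
  by exists x.
exact: pblock_in.
Qed.

Lemma peq_refl V x : peq V x x. Proof. by rewrite peqE. Qed.
Lemma peq_sym V x y : peq V x y = peq V y x.
Proof. by rewrite !peqE eq_sym. Qed.
Lemma peq_trans V : transitive (peq V).
Proof. by move=> y x z; rewrite !peqE => /eqP-> /eqP->. Qed.

Lemma pleq_antisym V W : partition V [set: T] -> partition W [set: T] ->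
  pleq V W -> pleq W V -> V = W.
Proof.
move=> pV pW VW WV; rewrite (part_image pV) (part_image pW).
apply: eq_imset => x; apply/setP=> y.
by rewrite -!peq_mem //; apply/idP/idP => [/VW|/WV].
Qed.

Lemma refinesP V W : partition V [set: T] -> partition W [set: T] ->
  reflect (pleq V W) (refines V W).
Proof.
move=> pV pW; apply: (iffP forall_inP) => [VW x y|VW B /(in_partP pV)[x ->]].
  rewrite peq_mem // => yx.
  have /exists_inP[C CW /subsetP sub] := VW _ (pblock_in x pV).
  have [_ tW _] := and3P pW.
  rewrite peq_mem // (def_pblock tW CW (sub _ (pblock_id x pV))); exact: sub.
apply/exists_inP; exists (pblock W x); first exact: pblock_in.
by apply/subsetP=> y; rewrite -!peq_mem //; apply: VW.
Qed.

Lemma kpart_partition (rT : eqType) (g : T -> rT) :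
  partition (kpart g) [set: T].
Proof. exact: preim_partitionP. Qed.

#[local] Hint Resolve kpart_partition : core.

Lemma peq_kpart (rT : eqType) (g : T -> rT) x y :
  peq (kpart g) x y = (g x == g y).
Proof.
rewrite peq_mem ?kpart_partition // /kpart /preim_partition.
rewrite pblock_equivalence_partition ?inE //.
by move=> a b c _ _ _ /=; split=> [|/eqP->].
Qed.

Lemma card_kpart (rT : finType) (g : T -> rT) :
  nblk (kpart g) = #|g @: [set: T]|.
Proof.
rewrite nblkE.
pose k (z : rT) := [set y | z == g y].
have -> : kpart g = k @: (g @: [set: T]).
  apply/setP=> B; apply/imsetP/imsetP => [[x _ ->]|[_ /imsetP[x _ ->] ->]].
    by exists (g x); rewrite ?imset_f // /k; apply/setP=> y; rewrite !inE.
  by exists x => //; apply/setP=> y; rewrite !inE.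
apply: card_in_imset => _ _ /imsetP[x _ ->] /imsetP[y _ ->] /setP/(_ y).
by rewrite !inE eqxx => /eqP.
Qed.

Lemma pleq_pjoinl V W : partition V [set: T] -> pleq V (pjoin V W).
Proof.
by move=> pV; apply/refinesP; rewrite ?pjoin_partition ?refines_pjoinl.
Qed.

Lemma pleq_pjoinr V W : partition W [set: T] -> pleq W (pjoin V W).
Proof.
by move=> pV; apply/refinesP; rewrite ?pjoin_partition ?refines_pjoinr.
Qed.

Lemma pjoin_lub V W U : partition V [set: T] -> partition W [set: T] ->
  partition U [set: T] -> pleq V U -> pleq W U -> pleq (pjoin V W) U.
Proof.
move=> pV pW pU VU WU; apply/refinesP=> //.
by apply: pjoin_least => //; apply/refinesP.
Qed.

(** The kernel partition of [g] is an upper bound of [V] and [W], hence of their join. This replaces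
    arguments along connecting paths. *)
Lemma pjoin_invariant V W (rT : eqType) (g : T -> rT) :
  partition V [set: T] -> partition W [set: T] ->
  (forall x y, peq V x y -> g x = g y) ->
  (forall x y, peq W x y -> g x = g y) ->
  forall x y, peq (pjoin V W) x y -> g x = g y.
Proof.
move=> pV pW VU WU x y.
move/(pjoin_lub (U := kpart g) pV pW (kpart_partition g)).
rewrite peq_kpart => h; apply/eqP; apply: h => {}x {}y.
  by move/VU; rewrite peq_kpart => ->.
by move/WU; rewrite peq_kpart => ->.
Qed.

Lemma pjoinC V W : pjoin V W = pjoin W V.
Proof. by rewrite /pjoin /same_block setUC. Qed.

Lemma pleq_trans V W U : pleq V W -> pleq W U -> pleq V U.
Proof. by move=> VW WU x y /VW/WU. Qed.

Lemma pjoinA U V W : partition U [set: T] -> partition V [set: T] ->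
  partition W [set: T] -> pjoin U (pjoin V W) = pjoin (pjoin U V) W.
Proof.
move=> pU pV pW; apply: pleq_antisym => //; apply: pjoin_lub => //.
- exact: pleq_trans (pleq_pjoinl _ pU) (pleq_pjoinl _ (pjoin_partition _ _)).
- apply: pjoin_lub => //; last exact: pleq_pjoinr.
  exact: pleq_trans (pleq_pjoinr _ pV) (pleq_pjoinl _ (pjoin_partition _ _)).
- apply: pjoin_lub => //; first exact: pleq_pjoinl.
  exact: pleq_trans (pleq_pjoinl _ pV) (pleq_pjoinr _ (pjoin_partition _ _)).
- exact: pleq_trans (pleq_pjoinr _ pW) (pleq_pjoinr _ (pjoin_partition _ _)).
Qed.

Lemma pjoin_absorb V W : partition V [set: T] -> partition W [set: T] ->
  pleq W V -> pjoin V W = V.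
Proof.
move=> pV pW WV; apply: pleq_antisym=> //.
  exact: pjoin_lub.
exact: pleq_pjoinl.
Qed.

Lemma pjoin_mono V V' W W' : partition V [set: T] -> partition W [set: T] ->
  partition V' [set: T] -> partition W' [set: T] ->
  pleq V V' -> pleq W W' -> pleq (pjoin V W) (pjoin V' W').
Proof.
move=> pV pW pV' pW' VV WW; apply: pjoin_lub=> //.
  exact: pleq_trans VV (pleq_pjoinl _ _).
exact: pleq_trans WW (pleq_pjoinr _ _).
Qed.

Lemma part_card_le V : partition V [set: T] -> (nblk V <= npts T)%N.
Proof.
by move=> pV; rewrite nblkE nptsE (part_image pV) -cardsT leq_imset_card.
Qed.

Lemma pleq_card V W : partition V [set: T] -> partition W [set: T] ->
  pleq V W -> (nblk W <= nblk V)%N.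
Proof.
move=> pV pW VW.
have -> : W = (fun B : {set T} => if [pick x in B] is Some x then pblock W x else set0)
   @: V.
  rewrite [in RHS](part_image pV) -imset_comp [LHS](part_image pW).
  apply: eq_imset => x /=; case: pickP => [y|/(_ x)]; last first.
    by rewrite pblock_id.
  by rewrite -peq_mem // => /VW; rewrite peqE => /eqP.
by rewrite !nblkE leq_imset_card.
Qed.

Lemma peq_porbits (s : {perm T}) x y : peq (porbits s) x y = (y \in porbit s x).
Proof.
rewrite peq_mem ?porbits_partition //.
have [_ tS _] := and3P (porbits_partition s).
by rewrite (def_pblock tS (imset_f _ _) (porbit_id s x)).
Qed.

Lemma pblock_porbits (s : {perm T}) x : pblock (porbits s) x = porbit s x.
Proof.
by apply/setP=> y; rewrite -peq_porbits peq_mem ?porbits_partition.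
Qed.

Lemma porbits_invariant (s : {perm T}) (rT : Type) (g : T -> rT) :
  (forall x, g (s x) = g x) -> forall x y, peq (porbits s) x y -> g x = g y.
Proof.
move=> gs x y; rewrite peq_porbits => /porbitP[k ->].
elim: k => [|k IH]; first by rewrite expg0 perm1.
by rewrite expgSr permM gs.
Qed.

Lemma pleq_porbits (s : {perm T}) V :
  (pleq (porbits s) V) <-> (forall x, peq V x (s x)).
Proof.
split=> [sV x|sV x y]; first by apply/sV; rewrite peq_porbits (mem_porbit s 1).
move=> /(porbits_invariant (g := pblock V)) h; rewrite peqE.
by apply/eqP/h => z; apply/esym/eqP; rewrite -peqE; apply: sV.
Qed.

Lemma pleq_tperm V x y : pleq (porbits (tperm x y)) V <-> peq V x y.
Proof.
split=> [/pleq_porbits/(_ x)|xy]; first by rewrite tpermL.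
apply/pleq_porbits => z.
by case: tpermP => [->|->|_ _]; rewrite ?peq_refl // peq_sym.
Qed.

Lemma card_merge V x y : partition V [set: T] ->
  (nblk (pjoin V (porbits (tperm x y))) + ~~ peq V x y = nblk V)%N.
Proof.
move=> pV; have pt := porbits_partition (tperm x y).
case: (boolP (peq V x y)) => [xy|nxy].
  by rewrite addn0 pjoin_absorb //; apply/pleq_tperm.
(* Renaming the block of [y] to that of [x] realizes the join as a kernel partition; the image of
   the renaming is [V] without the block of [y]. *)
pose m (B : {set T}) := if B == pblock V y then pblock V x else B.
have -> : pjoin V (porbits (tperm x y)) = kpart (fun z => m (pblock V z)).
  apply: pleq_antisym=> //.
    apply: pjoin_lub=> //.
      by move=> a b; rewrite peqE => /eqP ab; rewrite peq_kpart ab.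
    by apply/pleq_tperm; rewrite peq_kpart /m eqxx; case: ifP.
  move=> a b; rewrite peq_kpart /m -!peqE.
  have xy : peq (pjoin V (porbits (tperm x y))) x y.
    by apply/pleq_tperm/pleq_pjoinr.
  have sub := pleq_pjoinl (porbits (tperm x y)) pV.
  case: ifP => [ay|_]; case: ifP => [biy|_]; rewrite -?peqE.
  - by move=> _; apply: sub; apply: peq_trans ay _; rewrite peq_sym.
  - move=> /sub xb; apply: peq_trans xb; apply: peq_trans (sub _ _ ay) _.
    by rewrite peq_sym.
  - move=> /sub xb; apply: peq_trans xb _; apply: peq_trans xy _.
    by apply: sub; rewrite peq_sym.
  - exact: sub.
rewrite card_kpart.
have -> : [set m (pblock V z) | z in [set: T]] = V :\ pblock V y.
  apply/setP=> B; rewrite !inE; apply/imsetP/andP => [[z _ ->]|[nB BV]].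
    by rewrite /m; case: ifP => [_|->]; rewrite -?peqE ?nxy pblock_in.
  have [z Bz] := in_partP pV BV.
  by exists z => //; rewrite /m -Bz (negPf nB).
by rewrite nblkE (cardsD1 (pblock V y) V) pblock_in // addnC.
Qed.

Lemma top_part_peq x y : peq (top_part T) x y.
Proof.
have := top_part_partition T => pT; rewrite peq_mem //.
have := pblock_in x pT; rewrite !inE => /andP[_ /eqP ->]; by rewrite inE.
Qed.

Lemma peq_top_part V : partition V [set: T] -> (forall x y, peq V x y) ->
  V = top_part T.
Proof.
move=> pV h; apply: pleq_antisym => //; first exact: top_part_partition.
by move=> x y _; apply: top_part_peq.
Qed.

End Partitions.

(** * Lengths and the partial product *)

(* Without the generalization [lia] would compute partitions. *)
Ltac nblk_lia :=
  repeat match goal with H : context [nblk _] |- _ => revert H end;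
  repeat match goal with |- context [nblk ?V] => generalize (nblk V) end;
  clear; intros; lia.


Section Lengths.
Variable T : finType.
Implicit Types (V W U : {set {set T}}) (x y : T) (s p : {perm T}).

(** Submodularity: [V] is reached from [V0] by merging two blocks at a time. Each merge lowers the
    block count of [V0] by one and that of the join with [W] by at most one. *)
Lemma card_pjoin_submod V0 V W :
  partition V0 [set: T] -> partition V [set: T] -> partition W [set: T] ->
  pleq V0 V -> (nblk V + nblk (pjoin V0 W) <= nblk (pjoin V W) + nblk V0)%N.
Proof.
move=> pV0 pV pW; move: {2}(nblk V0 - nblk V)%N (leqnn (nblk V0 - nblk V)) => m.
elim: m V0 pV0 => [|m IH] V0 pV0 lem V0V.
  have [/eqP ->|] := boolP (V0 == V); first by rewrite addnC.
  move=> nV; exfalso; move: nV; apply/negP; rewrite negbK; apply/eqP.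
  apply: pleq_antisym => // x y xy; apply/negPn/negP => nxy.
  have := card_merge x y pV0; rewrite nxy /= => cm.
  have h : pleq (pjoin V0 (porbits (tperm x y))) V.
    by apply: pjoin_lub => //; apply/pleq_tperm.
  have := pleq_card (pjoin_partition _ _) pV h; nblk_lia.
have [/exists_inP[x _ /existsP[y /andP[xy nxy]]]|] :=
    boolP [exists x in T, exists y, peq V x y && ~~ peq V0 x y].
  pose V1 := pjoin V0 (porbits (tperm x y)).
  have pV1 : partition V1 [set: T] by exact: pjoin_partition.
  have := card_merge x y pV0; rewrite nxy /= -/V1 => cm.
  have V1V : pleq V1 V by apply: pjoin_lub => //; apply/pleq_tperm.
  have c1 := pleq_card pV1 pV V1V.
  have : (nblk V + nblk (pjoin V1 W) <= nblk (pjoin V W) + nblk V1)%N by apply: IH => //; nblk_lia.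
  have := card_merge x y (pjoin_partition V0 W).
  have -> : pjoin (pjoin V0 W) (porbits (tperm x y)) = pjoin V1 W.
    rewrite [LHS]pjoinC /V1 [pjoin V0 (porbits _)]pjoinC; apply: pjoinA pV0 pW.
    exact: porbits_partition.
  have := leq_b1 (~~ peq (pjoin V0 W) x y); move: (~~ _) => b; nblk_lia.
move=> h; have -> : V0 = V; last by rewrite addnC.
apply: pleq_antisym => // x y xy; apply/negPn/negP => nxy; move/negP: h; apply.
by apply/exists_inP; exists x => //; apply/existsP; exists y; rewrite xy.
Qed.

Lemma nblk_tperm s x y :
  (nblk (porbits (tperm x y * s)%g) + (x \notin porbit s y).*2 =
   nblk (porbits s) + (x != y))%N.
Proof. by rewrite !nblkE; apply: porbits_mul_tperm. Qed.

(** The difference of the two sides is twice the total genus of the surface glued from [p] and [s].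
    The induction removes one transposition from [s] at a time. *)
Lemma genus_le p s : (nblk (porbits p) + nblk (porbits s) + nblk (porbits (s * p)%g)
  <= npts T + 2 * nblk (pjoin (porbits p) (porbits s)))%N.
Proof.
move: {2}(npts T - nblk (porbits s))%N (leqnn (npts T - nblk (porbits s))) => m.
elim: m s => [|m IH] s lem.
all: have [/eqP s1|s1] := boolP (s == 1%g).
1,3: rewrite s1 mul1g pjoin_absorb //;
  [have := part_card_le (porbits_partition (1%g : {perm T})); nblk_lia|
   apply/pleq_porbits => x; rewrite perm1; exact: peq_refl].
all: have [x sx] : exists x, s x != x
  by apply/existsP; apply: contraNT s1 => /existsPn h; apply/eqP/permP => x;
     rewrite perm1; apply/eqP/negPn.
all: have := nblk_tperm s x (s x).
all: have -> : x \in porbit s (s x)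
  by rewrite porbit_sym (mem_porbit s 1).
all: rewrite [x == _]eq_sym sx addn0 => cs'.
  have := part_card_le (porbits_partition (tperm x (s x) * s)%g); nblk_lia.
(* The permutation [s'] fixes [y], so it has one cycle more than [s]. *)
set y := s x in sx cs'; pose s' : {perm T} := (tperm x y * s)%g.
have es : s = (tperm x y * s')%g by rewrite /s' mulgA tperm2 mul1g.
rewrite -/s' /= in cs'.
have {}IH : (nblk (porbits p) + nblk (porbits s') + nblk (porbits (s' * p)%g)
  <= npts T + 2 * nblk (pjoin (porbits p) (porbits s')))%N by apply: IH; nblk_lia.
have le : pleq (pjoin (porbits p) (porbits s))
   (pjoin (pjoin (porbits p) (porbits s')) (porbits (tperm x y))).
  rewrite -pjoinA //; apply: pjoin_mono => //.
  apply/pleq_porbits => z.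
  have -> : s z = s' (tperm x y z) by rewrite /s' permM tpermK.
  apply: (@peq_trans _ _ (tperm x y z)).
    by apply: pleq_pjoinr => //; rewrite peq_porbits (mem_porbit _ 1).
  by apply: pleq_pjoinl => //; rewrite peq_porbits (mem_porbit _ 1).
have := pleq_card (pjoin_partition _ _) (pjoin_partition _ _) le.
have := card_merge x y (pjoin_partition (porbits p) (porbits s')).
have := nblk_tperm (s' * p)%g x y.
have -> : (tperm x y * (s' * p) = s * p)%g by rewrite [in RHS]es mulgA.
rewrite eq_sym sx.
(* If [x] and [y] are already joined, the product gains at most one cycle, which pays for the one
   lost by [s]. Otherwise the join may lose a block, but then [x] and [y] lie in different cycles of
   [s' * p] and the product loses a cycle as well. *)
case: (boolP (peq _ x y)) => [_|nxy]; first by case: (x \notin _) => /=; nblk_lia.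
have -> : x \notin porbit (s' * p)%g y; last by rewrite /=; nblk_lia.
apply: contra nxy; rewrite porbit_sym -peq_porbits.
suff le2 : pleq (T := T) (porbits (s' * p)%g) (pjoin (porbits p) (porbits s')).
  exact: le2.
refine (proj2 (pleq_porbits _ _) _) => z; rewrite permM.
apply: (@peq_trans _ _ (s' z)).
  by apply: pleq_pjoinr => //; rewrite peq_porbits (mem_porbit _ 1).
by apply: pleq_pjoinl => //; rewrite peq_porbits (mem_porbit _ 1).
Qed.

Section PP.
Implicit Types u v w : partperm T.

Lemma pp_partP u : partition (pp_part u) [set: T].
Proof. by have /andP[] := valP u. Qed.

Lemma pp_permP u : pleq (porbits (pp_perm u)) (pp_part u).
Proof.
by apply/refinesP => //; [exact: pp_partP|have /andP[] := valP u].
Qed.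

Lemma pp_peq u x : peq (pp_part u) x (pp_perm u x).
Proof. by apply/pp_permP; rewrite peq_porbits (mem_porbit _ 1). Qed.

Lemma is_partpermP V s : partition V [set: T] -> pleq (porbits s) V ->
  is_partperm (V, s).
Proof. by move=> pV sV; rewrite /is_partperm pV; apply/refinesP. Qed.

Lemma pp_ext u v : pp_part u = pp_part v -> pp_perm u = pp_perm v -> u = v.
Proof.
by case: u v => -[V s] Hu [[W t] Hv]; rewrite /pp_part /pp_perm /= => e1 e2;
  apply: val_inj; rewrite /= e1 e2.
Qed.

Lemma pp_lenE u :
  (pp_len u + 2 * nblk (pp_part u) = npts T + nblk (porbits (pp_perm u)))%N.
Proof.
have := pleq_card (porbits_partition _) (pp_partP u) (@pp_permP u).
have := part_card_le (porbits_partition (pp_perm u)).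
rewrite /pp_len /part_len /perm_len -!nblkE -!nptsE; nblk_lia.
Qed.

Definition pp_prod u v : partperm T := Sub _ (mul_is_partperm u v).

Lemma pp_prod_part u v :
  pp_part (pp_prod u v) = pjoin (pp_part u) (pp_part v).
Proof. by []. Qed.

Lemma pp_prod_perm u v : pp_perm (pp_prod u v) = (pp_perm v * pp_perm u)%g.
Proof. by []. Qed.

Lemma pp_mulE u v : pp_mul u v =
  if (pp_len u + pp_len v == pp_len (pp_prod u v))%N
  then Some (pp_prod u v) else None.
Proof. by []. Qed.

Lemma pp_mulP u v w : reflect
  (pp_prod u v = w /\ (pp_len u + pp_len v = pp_len w)%N)
  (pp_mul u v == Some w).
Proof.
rewrite pp_mulE; case: ifP => /eqP h; apply: (iffP eqP) => //.
- by case=> <-.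
- by case=> <-.
- by case=> e l; case: h; rewrite e.
Qed.

(** Two uses of submodularity, passing from cycles to blocks in [u] and then in [v], reduce the
    triangle inequality to the genus bound. *)
Lemma pp_len_prod u v : (pp_len (pp_prod u v) <= pp_len u + pp_len v)%N.
Proof.
have := (pp_lenE u, pp_lenE v, pp_lenE (pp_prod u v)).
rewrite pp_prod_part pp_prod_perm => -[[eu ev] ew].
have := genus_le (pp_perm u) (pp_perm v).
have := card_pjoin_submod (porbits_partition _) (pp_partP u) (pp_partP v)
  (@pp_permP u).
have := card_pjoin_submod (porbits_partition _) (pp_partP v)
  (porbits_partition (pp_perm u)) (@pp_permP v).
rewrite ![pjoin _ (porbits (pp_perm u))]pjoinC; nblk_lia.
Qed.

Lemma pp_prodA u v w : pp_prod u (pp_prod v w) = pp_prod (pp_prod u v) w.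
Proof.
apply: pp_ext; rewrite ?pp_prod_part ?pp_prod_perm ?mulgA //.
by rewrite pjoinA ?pp_partP.
Qed.

(** By the triangle inequality, either bracketing is nonzero exactly when the three lengths add up
    to the length of the full product, a condition without brackets. *)
Lemma pp_mulA u v w : obind (pp_mul u) (pp_mul v w) =
  obind (fun uv => pp_mul uv w) (pp_mul u v).
Proof.
have [l1 l2] := (pp_len_prod u v, pp_len_prod v w).
have := pp_len_prod u (pp_prod v w).
have := pp_len_prod (pp_prod u v) w; rewrite pp_prodA => l3 l4.
rewrite (pp_mulE v w) (pp_mulE u v).
case: eqP => e1; case: eqP => e2 /=; rewrite ?pp_mulE ?pp_prodA //.
- by rewrite -e1 -e2 addnA.
- by case: eqP => // e3; exfalso; move: l1 l2 l3 l4 e1 e2 e3; clear; lia.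
- by case: eqP => // e3; exfalso; move: l1 l2 l3 l4 e1 e2 e3; clear; lia.
Qed.

End PP.
End Lengths.

(** * The convolution algebra *)

Section ZetaSupport.
Variable T : finType.
Implicit Types (u v w : partperm T) (s : {perm T}).

Lemma is_partperm_porbits s : is_partperm (porbits s, s).
Proof. exact: is_partpermP. Qed.

Definition pp_perm_only s : partperm T := Sub _ (is_partperm_porbits s).

Definition pp_one := pp_perm_only 1.

Lemma porbit_fixed s x : s x = x -> porbit s x = [set x].
Proof.
move=> sx; apply/setP=> y; rewrite inE; apply/porbitP/eqP => [[k ->]|->].
  by elim: k => [|k IH]; rewrite ?expg0 ?perm1 // expgSr permM IH.
by exists 0%N; rewrite expg0 perm1.
Qed.

Lemma porbits1 : porbits (1 : {perm T})%g = [set [set x] | x in T].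
Proof. by apply: eq_imset => x; apply: porbit_fixed (perm1 x). Qed.

Lemma peq_one x y : peq (pp_part pp_one) x y = (x == y).
Proof. by rewrite peq_porbits (porbit_fixed (perm1 x)) inE eq_sym. Qed.

Lemma pp_prod1u u : pp_prod pp_one u = u.
Proof.
apply: pp_ext; last by rewrite pp_prod_perm mulg1.
rewrite pp_prod_part pjoinC pjoin_absorb ?pp_partP //.
by move=> x y; rewrite peq_one => /eqP->; apply: peq_refl.
Qed.

Lemma pp_produ1 u : pp_prod u pp_one = u.
Proof.
apply: pp_ext; last by rewrite pp_prod_perm mul1g.
rewrite pp_prod_part pjoin_absorb ?pp_partP //.
by move=> x y; rewrite peq_one => /eqP->; apply: peq_refl.
Qed.

Lemma pp_len_perm_only s :
  (pp_len (pp_perm_only s) + nblk (porbits s) = npts T)%N.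
Proof.
have := pp_lenE (pp_perm_only s).
rewrite -[pp_part _]/(porbits s) -[pp_perm _]/s; nblk_lia.
Qed.

Lemma nblk_porbits_max s : nblk (porbits s) = npts T -> s = 1%g.
Proof.
move=> e; apply/permP => x; rewrite perm1; apply/eqP/negPn/negP => sx.
have := nblk_tperm s x (s x); rewrite porbit_sym (mem_porbit s 1) eq_sym sx /=.
have := part_card_le (porbits_partition (tperm x (s x) * s)%g); nblk_lia.
Qed.

Lemma pp_len1 : pp_len pp_one = 0%N.
Proof.
have := pp_len_perm_only 1; rewrite [nblk _]nblkE porbits1 card_imset.
  by rewrite -nptsE -/pp_one; lia.
exact: set1_inj.
Qed.

Lemma pp_mul1u u : pp_mul pp_one u = Some u.
Proof. by apply/eqP/pp_mulP; rewrite pp_prod1u pp_len1. Qed.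

Lemma pp_mulu1 u : pp_mul u pp_one = Some u.
Proof. by apply/eqP/pp_mulP; rewrite pp_produ1 pp_len1 addn0. Qed.

End ZetaSupport.
Arguments pp_one {T}.

Section Conv.
Variables (K : nzRingType) (T : finType).
Implicit Types (f g h : {ffun partperm T -> K}) (u v w : partperm T).

Lemma convE f g u : conv f g u =
  \sum_v \sum_w (if pp_mul v w == Some u then f v * g w else 0).
Proof. by rewrite ffunE pair_big big_mkcond. Qed.

Lemma convP f g u : conv f g u =
  \sum_v \sum_(w | pp_mul v w == Some u) f v * g w.
Proof. by rewrite convE; apply: eq_bigr => v _; rewrite -big_mkcond. Qed.

Lemma pp_deltaE u : pp_delta u = (u == pp_one)%:R :> K.
Proof.
rewrite ffunE; case: (u =P pp_one) => [->|]; first by rewrite -porbits1 !eqxx.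
case: ifP => // /andP[/eqP e1 /eqP e2] []; apply: pp_ext => //.
by rewrite e2 -porbits1.
Qed.

Lemma pp_zetaE u : pp_zeta u = (u == pp_perm_only (pp_perm u))%:R :> K.
Proof.
rewrite ffunE; case: eqP => [e|ne]; first by rewrite (_ : _ == _) //; apply/eqP/pp_ext.
by case: eqP => // e; case: ne; rewrite {1}e.
Qed.

Lemma conv1f f : conv pp_delta f = f.
Proof.
apply/ffunP => u; rewrite convE (bigD1 pp_one) //= [X in _ + X]big1 ?addr0.
  rewrite (bigD1 u) //= pp_mul1u eqxx pp_deltaE eqxx mul1r big1 ?addr0 // => w nw.
  by rewrite pp_mul1u; case: eqP => // -[e]; rewrite e eqxx in nw.
move=> v /negPf nv; apply: big1 => w _; case: ifP => // _.
by rewrite pp_deltaE nv mul0r.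
Qed.

Lemma convf1 f : conv f pp_delta = f.
Proof.
apply/ffunP => u; rewrite convE (bigD1 u) //= [X in _ + X]big1 ?addr0.
  rewrite (bigD1 pp_one) //= pp_mulu1 eqxx pp_deltaE eqxx mulr1 big1 ?addr0 //.
  by move=> w /negPf nw; case: ifP => // _; rewrite pp_deltaE nw mulr0.
move=> v nv; apply: big1 => w _; case: ifP => // /eqP e; rewrite pp_deltaE.
have [ew|] := eqVneq; last by rewrite mulr0.
by move: e nv; rewrite ew pp_mulu1 => -[->]; rewrite eqxx.
Qed.

(** Eliminates the sum over the intermediate product in [convA]. *)
Lemma sum_option (F : partperm T -> K) (o : option (partperm T)) :
  \sum_u (if o == Some u then F u else 0) = if o is Some u then F u else 0.
Proof.
case: o => [u|]; last by rewrite big1.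
rewrite (bigD1 u) //= eqxx big1 ?addr0 // => v nv.
by case: eqP => // -[e]; rewrite e eqxx in nv.
Qed.

Lemma convA f g h : conv f (conv g h) = conv (conv f g) h.
Proof.
apply/ffunP => u; rewrite !convE.
(* Both sides are brought to a sum over triples with iterated product [u]; [pp_mulA] identifies the
   two bracketings. *)
transitivity (\sum_(v : partperm T) \sum_(w : partperm T) \sum_(x : partperm T)
    if obind (pp_mul v) (pp_mul w x) == Some u then f v * (g w * h x) else 0).
  apply: eq_bigr => v _.
  transitivity (\sum_(y : partperm T) \sum_(w : partperm T) \sum_(x : partperm T)
    (if pp_mul w x == Some y then
     (if pp_mul v y == Some u then f v * (g w * h x) else 0) else 0)).
    apply: eq_bigr => y _; rewrite convE; case: ifP => _; last first.
      by rewrite big1 // => w _; rewrite big1 // => x _; case: ifP.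
    rewrite mulr_sumr; apply: eq_bigr => w _; rewrite mulr_sumr.
    by apply: eq_bigr => x _; case: ifP; rewrite ?mulr0.
  rewrite exchange_big; apply: eq_bigr => w _.
  rewrite exchange_big; apply: eq_bigr => x _.
  by rewrite (sum_option (fun y => if pp_mul v y == Some u then _ else _)); case: (pp_mul w x).
transitivity (\sum_(v : partperm T) \sum_(w : partperm T) \sum_(x : partperm T)
    if obind (fun y : partperm T => pp_mul y x) (pp_mul v w) == Some u then f v * g w * h x else 0).
  apply: eq_bigr => v _; apply: eq_bigr => w _; apply: eq_bigr => x _.
  by rewrite pp_mulA mulrA.
transitivity (\sum_(v : partperm T) \sum_(w : partperm T) \sum_(x : partperm T) \sum_(y : partperm T)
    (if pp_mul v w == Some y then
     (if pp_mul y x == Some u then f v * g w * h x else 0) else 0)).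
  apply: eq_bigr => v _; apply: eq_bigr => w _; apply: eq_bigr => x _.
  by rewrite (sum_option (fun y => if pp_mul y x == Some u then _ else _)); case: (pp_mul v w).
transitivity (\sum_(y : partperm T) \sum_(x : partperm T) \sum_(v : partperm T) \sum_(w : partperm T)
    (if pp_mul v w == Some y then
     (if pp_mul y x == Some u then f v * g w * h x else 0) else 0)); last first.
  apply: eq_bigr => y _; apply: eq_bigr => x _; rewrite convE.
  case: ifP => _; last by rewrite big1 // => v _; rewrite big1 // => w _; case: ifP.
  rewrite mulr_suml; apply: eq_bigr => v _; rewrite mulr_suml.
  by apply: eq_bigr => w _; case: ifP; rewrite ?mul0r.
transitivity (\sum_(y : partperm T) \sum_(v : partperm T) \sum_(w : partperm T) \sum_(x : partperm T)
    (if pp_mul v w == Some y then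
     (if pp_mul y x == Some u then f v * g w * h x else 0) else 0)).
  rewrite [RHS]exchange_big; apply: eq_bigr => v _.
  by rewrite [RHS]exchange_big; apply: eq_bigr => w _; rewrite exchange_big.
apply: eq_bigr => y _; rewrite [RHS]exchange_big; apply: eq_bigr => v _.
by rewrite exchange_big.
Qed.

End Conv.

(** * Invertibility of the zeta function *)

Section Inverse.
Variables (K : fieldType) (T : finType).
Implicit Types (f g h : {ffun partperm T -> K}) (u v w : partperm T).

(* [pp_len] filters the convolution algebra and [pp_zeta] is [pp_delta] plus
   terms of positive length, so convolving with it is unitriangular. *)
Lemma conv_zeta_inj0 f : conv f pp_zeta = 0 -> f = 0.
Proof.
move=> f0; apply/ffunP => u; rewrite ffunE.
have [m] := ubnP (pp_len u); elim: m u => // m IH u lem.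
have /ffunP/(_ u) := f0; rewrite convE ffunE (bigD1 u) //= [X in _ + X]big1.
  rewrite addr0 (bigD1 pp_one) //= pp_mulu1 eqxx pp_zetaE eqxx mulr1 big1.
    by rewrite addr0.
  move=> w nw; case: ifP => // /pp_mulP[_ l].
  rewrite pp_zetaE; case: eqP => [ew|_]; last by rewrite mulr0.
  case/eqP: nw; rewrite ew; congr pp_perm_only; apply: nblk_porbits_max.
  have := pp_len_perm_only (pp_perm w); rewrite -ew; move: l.
  move: (pp_len u) (pp_len w) (nblk _) (npts T) => a b c d; lia.
move=> v nv; apply: big1 => w _; case: ifP => // /pp_mulP[e l].
have [w1|nw] := eqVneq w pp_one.
  by move: e nv; rewrite w1 pp_produ1 => ->; rewrite eqxx.
rewrite pp_zetaE; case: eqP => [ew|_]; last by rewrite mulr0.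
rewrite IH ?mul0r //; case: (posnP (pp_len w)) => [l0|lw]; last first.
  by move: l lem lw; clear; lia.
case/eqP: nw; rewrite ew; congr pp_perm_only; apply: nblk_porbits_max.
by have := pp_len_perm_only (pp_perm w); rewrite -ew l0.
Qed.

(** [K^o] is [K] as a module over itself; it turns the functions into a finite-dimensional vector
    space. *)
Definition conv_zeta (f : {ffun partperm T -> K^o}) :
  {ffun partperm T -> K^o} := conv f pp_zeta.

Lemma conv_zeta_linear : linear conv_zeta.
Proof.
move=> c f g; apply/ffunP => u; rewrite !ffunE scaler_sumr -big_split /=.
by apply: eq_bigr => p _; rewrite !ffunE mulrDl scalerAl.
Qed.

HB.instance Definition _ := GRing.isLinear.Build K _ _ _ _ conv_zeta_linear.

(** An injective endomorphism of a finite-dimensional space is bijective, which yields a left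
    inverse [m]. It is also a right inverse, since [conv pp_zeta m] and [pp_delta] have the same
    convolution with [pp_zeta]. *)
Lemma pp_muP : conv_inverse (pp_zeta : {ffun partperm T -> K}) pp_mu.
Proof.
rewrite /pp_mu; apply: (@xgetPex _ _ (conv_inverse _)).
pose L : 'End({ffun partperm T -> K^o}) := linfun conv_zeta.
have L0 : lker L == 0%VS.
  rewrite -subv0; apply/subvP => f; rewrite memv_ker lfunE /= => /eqP.
  by move/conv_zeta_inj0 ->; rewrite mem0v.
pose m : {ffun partperm T -> K} := L^-1%VF pp_delta.
have muz : conv m pp_zeta = pp_delta.
  by have := lker0_lfunVK L0 pp_delta; rewrite lfunE.
exists m; split => //; apply/eqP; rewrite -subr_eq0; apply/eqP/conv_zeta_inj0.
apply: etrans (raddfB conv_zeta _ _) _.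
have e : conv (conv pp_zeta m) pp_zeta - conv pp_delta pp_zeta = 0.
  by rewrite -convA muz conv1f convf1 subrr.
exact: e.
Qed.

Lemma conv_zeta_mu f : conv (conv f pp_zeta) pp_mu = f.
Proof. by rewrite -convA pp_muP.1 convf1. Qed.

Lemma conv_mu_zeta f : conv (conv f pp_mu) pp_zeta = f.
Proof. by rewrite -convA pp_muP.2 convf1. Qed.

(** Convolving back with [pp_mu] at [u] only involves left factors of [u], so agreement on a set
    closed under left factors suffices. *)
Lemma conv_zeta_eq_on (F : pred (partperm T)) f g :
  (forall u v w, pp_mul v w == Some u -> F u -> F v) ->
  (forall u, F u -> conv f pp_zeta u = conv g pp_zeta u) ->
  forall u, F u -> f u = g u.
Proof.
move=> Fdown fg u Fu; rewrite -(conv_zeta_mu f) -(conv_zeta_mu g) !convP.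
by apply: eq_bigr => v _; apply: eq_bigr => w vw; rewrite fg // (Fdown _ _ _ vw).
Qed.

End Inverse.

(** * Disjoint unions *)

#[local] Hint Resolve kpart_partition : core.
#[local] Hint Resolve pp_partP : core.

Section DirectSum.
Variables (T1 T2 T : finType) (g : T1 + T2 -> T) (h : T -> T1 + T2).
Hypotheses (gK : cancel g h) (hK : cancel h g).

(** The union is taken along an arbitrary bijection [g], so that one treatment covers adding a point
    ([T + unit]), cutting out a block, and relabelling ([T' + void]). *)
Definition sum_inl x := g (inl x).
Definition sum_inr y := g (inr y).
Local Notation f1 := sum_inl.
Local Notation f2 := sum_inr.

Lemma sum_inl_inj : injective f1.
Proof. by move=> x y /(can_inj gK) []. Qed.

Lemma sum_inr_inj : injective f2.
Proof. by move=> x y /(can_inj gK) []. Qed.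

Variant sum_spec (z : T) : Type :=
  | SumL x of z = f1 x | SumR y of z = f2 y.

Lemma sumP z : sum_spec z.
Proof. by rewrite -(hK z); case: (h z) => x; [apply: (@SumL _ x)|apply: (@SumR _ x)]. Qed.

Lemma sum_inlrF x y : (f1 x == f2 y) = false.
Proof. by apply/eqP => e; have := can_inj gK e. Qed.

Lemma inl_memF x (B : {set T2}) : (f1 x \in f2 @: B) = false.
Proof. by apply/imsetP => -[y _ /eqP]; rewrite sum_inlrF. Qed.

Lemma inr_memF y (B : {set T1}) : (f2 y \in f1 @: B) = false.
Proof. by apply/imsetP => -[x _ /eqP]; rewrite eq_sym sum_inlrF. Qed.

Lemma npts_sum : npts T = (npts T1 + npts T2)%N.
Proof.
rewrite !nptsE -card_sum; apply: (bij_eq_card (Bijective hK gK)).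
Qed.

Definition sum_part (V1 : {set {set T1}}) (V2 : {set {set T2}}) :
    {set {set T}} :=
  [set f1 @: (B : {set T1}) | B in V1] :|: [set f2 @: (B : {set T2}) | B in V2].

Lemma sum_part_disjoint V1 (V2 : {set {set T2}}) : partition V1 [set: T1] ->
  [set f1 @: (B : {set T1}) | B in V1] :&:
  [set f2 @: (B : {set T2}) | B in V2] = set0.
Proof.
case/and3P=> _ _ V10; apply/setP=> B; rewrite !inE.
apply/negP=> /andP[/imsetP[B1 B1V ->] /imsetP[B2 _ /setP e]].
have /set0Pn[x xB] : B1 != set0 by apply: contraNneq V10 => <-.
by have := e (f1 x); rewrite inl_memF imset_f.
Qed.

Lemma sum_part_partition V1 V2 : partition V1 [set: T1] ->
  partition V2 [set: T2] -> partition (sum_part V1 V2) [set: T].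
Proof.
move=> pV1 pV2; have [[_ t1 n1] [_ t2 n2]] := (and3P pV1, and3P pV2).
apply/and3P; split.
- rewrite eqEsubset subsetT; apply/subsetP => z _; apply/bigcupP.
  case: (sumP z) => x ->.
    exists (f1 @: pblock V1 x); last by rewrite imset_f ?pblock_id.
    by rewrite inE imset_f ?pblock_in.
  exists (f2 @: pblock V2 x); last by rewrite imset_f ?pblock_id.
  by rewrite inE orbC imset_f ?pblock_in.
- apply/trivIsetP => _ _ /setUP[]/imsetP[B BV ->] /setUP[]/imsetP[C CV ->] BC.
  + rewrite imset_disjoint; last exact: sum_inl_inj.
    by apply: (trivIsetP t1) => //; apply: contraNneq BC => ->.
  + by apply/pred0P => z /=; case: (sumP z) => x ->; rewrite ?inl_memF ?inr_memF ?andbF.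
  + by apply/pred0P => z /=; case: (sumP z) => x ->; rewrite ?inl_memF ?inr_memF ?andbF.
  + rewrite imset_disjoint; last exact: sum_inr_inj.
    by apply: (trivIsetP t2) => //; apply: contraNneq BC => ->.
- rewrite inE; apply/orP => -[]/imsetP[B BV /esym/eqP].
    by rewrite imset_eq0 => /eqP B0; rewrite -B0 BV in n1.
  by rewrite imset_eq0 => /eqP B0; rewrite -B0 BV in n2.
Qed.

Section PartFacts.
Variables (V1 : {set {set T1}}) (V2 : {set {set T2}}).
Hypotheses (pV1 : partition V1 [set: T1]) (pV2 : partition V2 [set: T2]).

Lemma pblock_sum_inl x : pblock (sum_part V1 V2) (f1 x) = f1 @: pblock V1 x.
Proof.
have [_ t _] := and3P (sum_part_partition pV1 pV2).
apply: (def_pblock t); last by rewrite imset_f ?pblock_id.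
by rewrite inE imset_f ?pblock_in.
Qed.

Lemma pblock_sum_inr x : pblock (sum_part V1 V2) (f2 x) = f2 @: pblock V2 x.
Proof.
have [_ t _] := and3P (sum_part_partition pV1 pV2).
apply: (def_pblock t); last by rewrite imset_f ?pblock_id.
by rewrite inE orbC imset_f ?pblock_in.
Qed.

Lemma peq_sum_inl x y : peq (sum_part V1 V2) (f1 x) (f1 y) = peq V1 x y.
Proof.
rewrite !peq_mem ?sum_part_partition // pblock_sum_inl mem_imset //.
exact: sum_inl_inj.
Qed.

Lemma peq_sum_inr x y : peq (sum_part V1 V2) (f2 x) (f2 y) = peq V2 x y.
Proof.
rewrite !peq_mem ?sum_part_partition // pblock_sum_inr mem_imset //.
exact: sum_inr_inj.
Qed.

Lemma peq_sum_inlr x y : peq (sum_part V1 V2) (f1 x) (f2 y) = false.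
Proof. by rewrite peq_mem ?sum_part_partition // pblock_sum_inl inr_memF. Qed.

Lemma peq_sum_inrl x y : peq (sum_part V1 V2) (f2 x) (f1 y) = false.
Proof. by rewrite peq_sym peq_sum_inlr. Qed.

Lemma nblk_sum : nblk (sum_part V1 V2) = (nblk V1 + nblk V2)%N.
Proof.
rewrite !nblkE /sum_part cardsU sum_part_disjoint //.
rewrite cards0 subn0 !card_imset //; apply: imset_inj.
  exact: sum_inr_inj.
exact: sum_inl_inj.
Qed.

Lemma pleq_sum V : (forall x y, peq V1 x y -> peq V (f1 x) (f1 y)) ->
  (forall x y, peq V2 x y -> peq V (f2 x) (f2 y)) -> pleq (sum_part V1 V2) V.
Proof.
move=> h1 h2 a b; case: (sumP a) => x ->; case: (sumP b) => y ->.
- by rewrite peq_sum_inl; apply: h1.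
- by rewrite peq_sum_inlr.
- by rewrite peq_sum_inrl.
- by rewrite peq_sum_inr; apply: h2.
Qed.

End PartFacts.

Definition sum_fun (s1 : {perm T1}) (s2 : {perm T2}) (z : T) : T :=
  match h z with inl x => f1 (s1 x) | inr y => f2 (s2 y) end.

Lemma sum_fun_inj s1 s2 : injective (sum_fun s1 s2).
Proof.
move=> a b; rewrite /sum_fun -{2}(hK a) -{2}(hK b).
case: (h a) (h b) => x [] y.
- by move/sum_inl_inj/perm_inj ->.
- by move/eqP; rewrite sum_inlrF.
- by move/esym/eqP; rewrite sum_inlrF.
- by move/sum_inr_inj/perm_inj ->.
Qed.

Definition sum_perm s1 s2 : {perm T} := perm (@sum_fun_inj s1 s2).

Lemma sum_perm_inl s1 s2 x : sum_perm s1 s2 (f1 x) = f1 (s1 x).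
Proof. by rewrite permE /sum_fun gK. Qed.

Lemma sum_perm_inr s1 s2 y : sum_perm s1 s2 (f2 y) = f2 (s2 y).
Proof. by rewrite permE /sum_fun gK. Qed.

Lemma sum_permX_inl s1 s2 k x :
  (sum_perm s1 s2 ^+ k)%g (f1 x) = f1 ((s1 ^+ k)%g x).
Proof.
by elim: k => [|k IH]; rewrite ?expg0 ?perm1 // !expgSr !permM IH sum_perm_inl.
Qed.

Lemma sum_permX_inr s1 s2 k x :
  (sum_perm s1 s2 ^+ k)%g (f2 x) = f2 ((s2 ^+ k)%g x).
Proof.
by elim: k => [|k IH]; rewrite ?expg0 ?perm1 // !expgSr !permM IH sum_perm_inr.
Qed.

Lemma sum_permM s1 s2 t1 t2 :
  (sum_perm s1 s2 * sum_perm t1 t2)%g = sum_perm (s1 * t1)%g (s2 * t2)%g.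
Proof.
apply/permP => z; rewrite permM.
by case: (sumP z) => x ->; rewrite !(sum_perm_inl, sum_perm_inr) permM.
Qed.

Lemma porbit_sum_inl s1 s2 x :
  porbit (sum_perm s1 s2) (f1 x) = f1 @: porbit s1 x.
Proof.
apply/setP => z; apply/porbitP/imsetP => [[k ->]|[y /porbitP[k ->] ->]].
  by exists ((s1 ^+ k)%g x); rewrite ?mem_porbit ?sum_permX_inl.
by exists k; rewrite sum_permX_inl.
Qed.

Lemma porbit_sum_inr s1 s2 x :
  porbit (sum_perm s1 s2) (f2 x) = f2 @: porbit s2 x.
Proof.
apply/setP => z; apply/porbitP/imsetP => [[k ->]|[y /porbitP[k ->] ->]].
  by exists ((s2 ^+ k)%g x); rewrite ?mem_porbit ?sum_permX_inr.
by exists k; rewrite sum_permX_inr.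
Qed.

Lemma porbits_sum s1 s2 :
  porbits (sum_perm s1 s2) = sum_part (porbits s1) (porbits s2).
Proof.
apply/setP => B; rewrite inE; apply/imsetP/orP => [[z _ ->]|].
  case: (sumP z) => x ->; [left|right].
    by rewrite porbit_sum_inl !imset_f.
  by rewrite porbit_sum_inr !imset_f.
case=> /imsetP[_ /imsetP[x _ ->] ->].
  by exists (f1 x); rewrite ?porbit_sum_inl.
by exists (f2 x); rewrite ?porbit_sum_inr.
Qed.

Lemma pjoin_sum V1 V2 W1 W2 : partition V1 [set: T1] ->
  partition V2 [set: T2] -> partition W1 [set: T1] -> partition W2 [set: T2] ->
  pjoin (sum_part V1 V2) (sum_part W1 W2) =
  sum_part (pjoin V1 W1) (pjoin V2 W2).
Proof.
move=> p1 p2 q1 q2.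
have [pV pW] := (sum_part_partition p1 p2, sum_part_partition q1 q2).
have pS : partition (sum_part (pjoin V1 W1) (pjoin V2 W2)) [set: T].
  exact: sum_part_partition.
apply: pleq_antisym; [exact: pjoin_partition|exact: pS| |].
  apply: pjoin_lub => //; apply: pleq_sum => // x y.
  - by rewrite peq_sum_inl //; apply: pleq_pjoinl.
  - by rewrite peq_sum_inr //; apply: pleq_pjoinl.
  - by rewrite peq_sum_inl //; apply: pleq_pjoinr.
  - by rewrite peq_sum_inr //; apply: pleq_pjoinr.
apply: pleq_sum => // x y;
  [rewrite [peq _ (f1 x) _]peqE|rewrite [peq _ (f2 x) _]peqE] => xy;
  apply/eqP; move: x y xy.
  apply: pjoin_invariant => // x y xy; apply/eqP; rewrite -peqE.
    by apply: pleq_pjoinl; rewrite ?peq_sum_inl.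
  by apply: pleq_pjoinr; rewrite ?peq_sum_inl.
apply: pjoin_invariant => // x y xy; apply/eqP; rewrite -peqE.
  by apply: pleq_pjoinl; rewrite ?peq_sum_inr.
by apply: pleq_pjoinr; rewrite ?peq_sum_inr.
Qed.

Section SumPartPerm.

Lemma sum_is_partperm (u1 : partperm T1) (u2 : partperm T2) :
  is_partperm (sum_part (pp_part u1) (pp_part u2),
               sum_perm (pp_perm u1) (pp_perm u2)).
Proof.
apply: is_partpermP; first by apply: sum_part_partition.
rewrite porbits_sum; apply: pleq_sum => // x y.
  by rewrite peq_sum_inl //; apply: pp_permP.
by rewrite peq_sum_inr //; apply: pp_permP.
Qed.

Definition pp_sum u1 u2 : partperm T := Sub _ (sum_is_partperm u1 u2).

Lemma pp_sum_part u1 u2 :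
  pp_part (pp_sum u1 u2) = sum_part (pp_part u1) (pp_part u2).
Proof. by []. Qed.

Lemma pp_sum_perm u1 u2 :
  pp_perm (pp_sum u1 u2) = sum_perm (pp_perm u1) (pp_perm u2).
Proof. by []. Qed.

Lemma pp_len_sum u1 u2 : pp_len (pp_sum u1 u2) = (pp_len u1 + pp_len u2)%N.
Proof.
have := (pp_lenE u1, pp_lenE u2, pp_lenE (pp_sum u1 u2)).
rewrite pp_sum_part pp_sum_perm porbits_sum !nblk_sum // npts_sum.
move=> [[]]; nblk_lia.
Qed.

Lemma pp_sum_inj u1 u2 v1 v2 : pp_sum u1 u2 = pp_sum v1 v2 ->
  u1 = v1 /\ u2 = v2.
Proof.
move=> e; have eP : pp_part (pp_sum u1 u2) = pp_part (pp_sum v1 v2) by rewrite e.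
have eS : pp_perm (pp_sum u1 u2) = pp_perm (pp_sum v1 v2) by rewrite e.
rewrite !pp_sum_part in eP; rewrite !pp_sum_perm in eS.
split; apply: pp_ext.
- apply: pleq_antisym => // x y.
    by rewrite -(peq_sum_inl (pp_partP u1) (pp_partP u2)) eP peq_sum_inl.
  by rewrite -(peq_sum_inl (pp_partP v1) (pp_partP v2)) -eP peq_sum_inl.
- apply/permP => x; have := congr1 (fun s : {perm T} => s (f1 x)) eS.
  by rewrite /= !sum_perm_inl => /sum_inl_inj.
- apply: pleq_antisym => // x y.
    by rewrite -(peq_sum_inr (pp_partP u1) (pp_partP u2)) eP peq_sum_inr.
  by rewrite -(peq_sum_inr (pp_partP v1) (pp_partP v2)) -eP peq_sum_inr.
- apply/permP => x; have := congr1 (fun s : {perm T} => s (f2 x)) eS.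
  by rewrite /= !sum_perm_inr => /sum_inr_inj.
Qed.

Lemma pp_prod_sum u1 u2 v1 v2 :
  pp_prod (pp_sum u1 u2) (pp_sum v1 v2) = pp_sum (pp_prod u1 v1) (pp_prod u2 v2).
Proof.
apply: pp_ext.
  by rewrite pp_prod_part !pp_sum_part pjoin_sum.
by rewrite pp_prod_perm !pp_sum_perm sum_permM.
Qed.

(** Lengths add over the two parts and each part obeys the triangle inequality, so equality for the
    sum forces equality in both parts. *)
Lemma pp_mul_sum u1 u2 v1 v2 w1 w2 :
  (pp_mul (pp_sum u1 u2) (pp_sum v1 v2) == Some (pp_sum w1 w2)) =
  (pp_mul u1 v1 == Some w1) && (pp_mul u2 v2 == Some w2).
Proof.
apply/pp_mulP/andP; rewrite pp_prod_sum !pp_len_sum.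
  case=> /pp_sum_inj[e1 e2] l.
  have := pp_len_prod u1 v1; have := pp_len_prod u2 v2; rewrite e1 e2 => l2 l1.
  by split; apply/pp_mulP; split=> //; move: l l1 l2; clear; lia.
case=> /pp_mulP[-> l1] /pp_mulP[-> l2]; split=> //.
by move: l1 l2; clear; lia.
Qed.

(** The permutation moves points within blocks and so preserves both halves; the two partitions are
    the traces of that of [v], written as kernels. *)
Lemma pp_sum_split v U1 U2 : partition U1 [set: T1] -> partition U2 [set: T2] ->
  pleq (pp_part v) (sum_part U1 U2) -> exists u1 u2, v = pp_sum u1 u2.
Proof.
move=> p1 p2 le.
have ex1 x : exists y, pp_perm v (f1 x) == f1 y.
  have := le _ _ (pp_peq v (f1 x)); case: (sumP (pp_perm v (f1 x))) => y ->.
    by exists y.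
  by rewrite peq_sum_inlr.
have ex2 x : exists y, pp_perm v (f2 x) == f2 y.
  have := le _ _ (pp_peq v (f2 x)); case: (sumP (pp_perm v (f2 x))) => y ->.
    by rewrite peq_sum_inrl.
  by exists y.
pose k1 x := xchoose (ex1 x); pose k2 x := xchoose (ex2 x).
have k1P x : pp_perm v (f1 x) = f1 (k1 x) by apply/eqP/(xchooseP (ex1 x)).
have k2P x : pp_perm v (f2 x) = f2 (k2 x) by apply/eqP/(xchooseP (ex2 x)).
have k1i : injective k1.
  by move=> x y e; apply/sum_inl_inj/(@perm_inj _ (pp_perm v)); rewrite !k1P e.
have k2i : injective k2.
  by move=> x y e; apply/sum_inr_inj/(@perm_inj _ (pp_perm v)); rewrite !k2P e.
have pp1 : is_partperm (kpart (fun x => pblock (pp_part v) (f1 x)), perm k1i).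
  apply: is_partpermP => //; apply/pleq_porbits => x.
  by rewrite peq_kpart permE -k1P -peqE pp_peq.
have pp2 : is_partperm (kpart (fun x => pblock (pp_part v) (f2 x)), perm k2i).
  apply: is_partpermP => //; apply/pleq_porbits => x.
  by rewrite peq_kpart permE -k2P -peqE pp_peq.
exists (Sub _ pp1), (Sub _ pp2); apply: pp_ext; last first.
  rewrite pp_sum_perm; apply/permP => z.
  by case: (sumP z) => x ->; rewrite ?sum_perm_inl ?sum_perm_inr permE.
rewrite pp_sum_part -[pp_part (Sub _ pp1)]/(kpart (fun x => pblock _ (f1 x))).
rewrite -[pp_part (Sub _ pp2)]/(kpart (fun x => pblock _ (f2 x))).
apply: pleq_antisym => //.
- by apply: sum_part_partition; apply: kpart_partition.
- move=> a b ab; have lab := le _ _ ab; move: lab ab.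
  case: (sumP a) => x ->; case: (sumP b) => y ->.
  + by move=> _ ab; rewrite peq_sum_inl ?kpart_partition // peq_kpart -peqE.
  + by rewrite peq_sum_inlr.
  + by rewrite peq_sum_inrl.
  + by move=> _ ab; rewrite peq_sum_inr ?kpart_partition // peq_kpart -peqE.
- apply: pleq_sum; try exact: kpart_partition.
    by move=> x y; rewrite peq_kpart -peqE.
  by move=> x y; rewrite peq_kpart -peqE.
Qed.

Lemma pp_mul_sum_split v w u1 u2 : pp_mul v w == Some (pp_sum u1 u2) ->
  (exists v1 v2, v = pp_sum v1 v2) /\ (exists w1 w2, w = pp_sum w1 w2).
Proof.
case/pp_mulP=> e _; move: (congr1 (@pp_part T) e); rewrite pp_prod_part pp_sum_part.
move=> eP; split.
  apply: (pp_sum_split (pp_partP u1) (pp_partP u2)); rewrite -eP.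
  exact: pleq_pjoinl.
apply: (pp_sum_split (pp_partP u1) (pp_partP u2)); rewrite -eP.
exact: pleq_pjoinr.
Qed.

(** Factors of a disjoint union have finer partitions and therefore split too, so its factorizations
    are the pairs of factorizations of the two parts. *)
Lemma conv_sum (K : comNzRingType) (F G : {ffun partperm T -> K})
    (F1 G1 : {ffun partperm T1 -> K}) (F2 G2 : {ffun partperm T2 -> K}) :
  (forall u1 u2, F (pp_sum u1 u2) = F1 u1 * F2 u2) ->
  (forall u1 u2, G (pp_sum u1 u2) = G1 u1 * G2 u2) ->
  forall u1 u2, conv F G (pp_sum u1 u2) = conv F1 G1 u1 * conv F2 G2 u2.
Proof.
move=> HF HG u1 u2; rewrite !ffunE big_distrlr pair_big /=.
pose k (q : (partperm T1 * partperm T1) * (partperm T2 * partperm T2)) :=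
  (pp_sum q.1.1 q.2.1, pp_sum q.1.2 q.2.2).
pose A := [set q : (partperm T1 * partperm T1) * (partperm T2 * partperm T2) |
   (pp_mul q.1.1 q.1.2 == Some u1) && (pp_mul q.2.1 q.2.2 == Some u2)].
rewrite (eq_bigl (mem (k @: A))) => [|[v w] /=]; last first.
  apply/idP/imsetP => [vw|[[[a b] [c d]] ]].
    have [[v1 [v2 ev]] [w1 [w2 ew]]] := pp_mul_sum_split vw.
    exists ((v1, w1), (v2, w2)); rewrite ?inE /= ?ev ?ew //.
    by rewrite -pp_mul_sum -ev -ew.
  by rewrite inE /= => /andP[m1 m2] [-> ->]; rewrite pp_mul_sum m1.
rewrite big_imset /=; last first.
  move=> [[a b] [c d]] [[a' b'] [c' d']] _ _ e.
  have /= [-> ->] := pp_sum_inj (congr1 fst e).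
  by have /= [-> ->] := pp_sum_inj (congr1 snd e).
apply: eq_big => [q|q _]; first by rewrite inE.
by rewrite HF HG mulrACA.
Qed.

Lemma zeta_sum (K : nzRingType) u1 u2 :
  pp_zeta (pp_sum u1 u2) = pp_zeta u1 * pp_zeta u2 :> K.
Proof.
rewrite !pp_zetaE -natrM mulnb; congr (nat_of_bool _)%:R.
apply/eqP/andP => [|[/eqP e1 /eqP e2]].
  have -> : pp_perm_only (pp_perm (pp_sum u1 u2)) =
      pp_sum (pp_perm_only (pp_perm u1)) (pp_perm_only (pp_perm u2)).
    by apply: pp_ext; rewrite // pp_sum_part -porbits_sum.
  by case/pp_sum_inj => <- <-.
apply: pp_ext => //; rewrite pp_sum_part e1 e2 /=.
by rewrite -[RHS]/(porbits (sum_perm _ _)) porbits_sum.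
Qed.

End SumPartPerm.
End DirectSum.

(** * Multiplicativity of moments and cumulants *)

Section Cyclic.
Variables (R : realType) (A : algType R[i]) (phi : seq A -> R[i]).
Hypothesis hphi : is_hops phi.

(** Rotation of a word, not conjugation by an invertible element: by traciality [phi] does not
    distinguish [x] from [y] in any argument. *)
Definition conj_prod (x y : A) := exists b c, x = b * c /\ y = c * b.

Lemma phi_map_conj (I : eqType) (r : seq I) (F G : I -> A) :
  {in r, forall i, conj_prod (F i) (G i)} ->
  phi [seq F i | i <- r] = phi [seq G i | i <- r].
Proof.
(* The prefix [s] collects the entries already exchanged. *)
move=> FG; suff H s : phi (s ++ [seq F i | i <- r]) =
    phi (s ++ [seq G i | i <- r]) by exact: (H [::]).
elim: r s FG => //= i r IH s FG; have [b [c [-> ->]]] := FG i (mem_head _ _).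
rewrite (hops_tracial hphi) -!cat_rcons IH // => j jr.
by apply: FG; rewrite inE jr orbT.
Qed.

Section OnePerm.
Variables (T : finType) (a : T -> A) (s : {perm T}).

Definition orbit_prod x := \prod_(k < #|porbit s x|) a ((s ^+ k)%g x).

Lemma permX_card x : (s ^+ #|porbit s x|)%g x = x.
Proof. by rewrite permX iter_porbit. Qed.

Lemma orbit_prod_conj x y : y \in porbit s x ->
  conj_prod (orbit_prod x) (orbit_prod y).
Proof.
move=> yx; have := yx; rewrite porbit_traject => /trajectP[i lti].
rewrite -permX => ey.
have eo : porbit s y = porbit s x by apply/eqP; rewrite eq_porbit_mem.
rewrite /orbit_prod eo; set n := #|porbit s x| in lti *.
(* The cycle is cut at position [i], where [y] sits; read from [y], the second piece comes first. *)
exists (\prod_(0 <= k < i) a ((s ^+ k)%g x)),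
       (\prod_(i <= k < n) a ((s ^+ k)%g x)); split.
  by rewrite -(big_mkord predT (fun k => a ((s ^+ k)%g x))) (big_cat_nat (leq0n i) (ltnW lti)).
rewrite -(big_mkord predT (fun k => a ((s ^+ k)%g y))).
rewrite (big_cat_nat (leq0n (n - i)) (leq_subr _ _)) /=; congr (_ * _).
  have e := big_addn 0 n i predT (fun k => a ((s ^+ k)%g x)); rewrite add0n in e.
  rewrite e; apply: eq_bigr => k _.
  by rewrite ey -permM -expgD addnC.
have e := big_addn 0 n (n - i) predT (fun k => a ((s ^+ k)%g y)).
rewrite add0n subKn 1?ltnW // in e; rewrite e.
apply: eq_bigr => k _; rewrite ey -permM -expgD addnC -addnA subnK 1?ltnW //.
by rewrite addnC expgD permM permX_card.
Qed.

Lemma cycle_prod_conj x : conj_prod (cycle_prod a s (porbit s x)) (orbit_prod x).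
Proof.
rewrite /cycle_prod; case: pickP => [y yx|/(_ x)]; last by rewrite porbit_id.
have -> : porbit s x = porbit s y by apply/esym/eqP; rewrite eq_porbit_mem.
by apply: orbit_prod_conj; rewrite porbit_sym.
Qed.

End OnePerm.

Lemma block_moment_transfer (T T' : finType) (a : T -> A) (a' : T' -> A)
    (s : {perm T}) (s' : {perm T'}) (V : {set T}) (V' : {set T'})
    (m : {set T} -> {set T'}) :
  injective m ->
  [set c in porbits s' | c \subset V'] = m @: [set c in porbits s | c \subset V] ->
  (forall c, c \in porbits s -> exists x y,
    [/\ c = porbit s x, m c = porbit s' y & orbit_prod a s x = orbit_prod a' s' y]) ->
  block_moment phi a s V = block_moment phi a' s' V'.
Proof.
move=> mi eD ex; rewrite /block_moment eD.
set D := [set c in porbits s | c \subset V].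
have -> : phi [seq cycle_prod a' s' c | c <- enum (m @: D)] =
    phi [seq cycle_prod a' s' (m c) | c <- enum D].
  apply: (hops_symmetric hphi); rewrite (map_comp (cycle_prod a' s') m).
  apply: perm_map; apply: uniq_perm; rewrite ?enum_uniq ?map_inj_uniq ?enum_uniq //.
  move=> c; rewrite mem_enum; apply/imsetP/mapP => -[d dD ->]; exists d => //.
    by rewrite mem_enum.
  by rewrite mem_enum in dD.
have exD c : c \in enum D -> exists x y,
    [/\ c = porbit s x, m c = porbit s' y & orbit_prod a s x = orbit_prod a' s' y].
  by rewrite mem_enum inE => /andP[cs _]; apply: ex.
pose F c := cycle_prod a s c; pose G c := cycle_prod a' s' (m c).
(* [cycle_prod] starts a cycle at an arbitrary point, which [m] need not respect. The product [O c]
   from matching starting points is a rotation of both sides. *)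
have /choice[O OP] c : exists o,
    c \in enum D -> conj_prod (F c) o /\ conj_prod (G c) o.
  have [cD|] := boolP (c \in enum D); last by exists 0.
  have [x [y [ec emc exy]]] := exD c cD.
  exists (orbit_prod a s x) => _; rewrite /F /G emc exy.
  by split; [rewrite ec -exy|]; apply: cycle_prod_conj.
have FO : {in enum D, forall c, conj_prod (F c) (O c)} by move=> c /OP[].
have GO : {in enum D, forall c, conj_prod (G c) (O c)} by move=> c /OP[].
by rewrite (phi_map_conj FO) (phi_map_conj GO).
Qed.

End Cyclic.

(** * Moments and cumulants of a disjoint union *)

Section SumMoment.
Variables (R : realType) (A : algType R[i]) (phi : seq A -> R[i]).
Hypothesis hphi : is_hops phi.
Variables (T1 T2 T : finType) (g : T1 + T2 -> T) (h : T -> T1 + T2).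
Hypotheses (gK : cancel g h) (hK : cancel h g).
Variable a : T -> A.
Local Notation f1 := (sum_inl g).
Local Notation f2 := (sum_inr g).
Local Notation sum_perm := (sum_perm gK hK).
Local Notation pp_sum := (pp_sum gK hK).

Lemma block_moment_inl s1 s2 (B : {set T1}) :
  block_moment phi a (sum_perm s1 s2) (f1 @: B) =
  block_moment phi (a \o f1) s1 B.
Proof.
symmetry; apply: (block_moment_transfer hphi (m := fun c => f1 @: c)).
- exact: imset_inj (sum_inl_inj gK).
- apply/setP => C; rewrite inE porbits_sum; apply/andP/imsetP.
    case=> /setUP[]/imsetP[c cs ->] sub.
      exists c => //; rewrite inE cs; apply/subsetP => x xc.
      have := subsetP sub (f1 x); rewrite imset_f // mem_imset; last exact: sum_inl_inj gK.
      exact.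
    case/imsetP: cs => x _ ec.
    have := subsetP sub (f2 x); rewrite imset_f ?ec ?porbit_id // (inr_memF gK).
    by move/(_ isT).
  case=> c; rewrite inE => /andP[cs sub] ->; split; last exact: imsetS.
  by rewrite inE imset_f.
- move=> _ /imsetP[x _ ->]; exists x, (f1 x); split=> //.
    by rewrite porbit_sum_inl.
  rewrite /orbit_prod porbit_sum_inl card_imset; last exact: sum_inl_inj gK.
  by apply: eq_bigr => k _; rewrite sum_permX_inl.
Qed.

Lemma block_moment_inr s1 s2 (B : {set T2}) :
  block_moment phi a (sum_perm s1 s2) (f2 @: B) =
  block_moment phi (a \o f2) s2 B.
Proof.
symmetry; apply: (block_moment_transfer hphi (m := fun c => f2 @: c)).
- exact: imset_inj (sum_inr_inj gK).
- apply/setP => C; rewrite inE porbits_sum; apply/andP/imsetP.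
    case=> /setUP[]/imsetP[c cs ->] sub.
      case/imsetP: cs => x _ ec.
      have := subsetP sub (f1 x); rewrite imset_f ?ec ?porbit_id // (inl_memF gK).
      by move/(_ isT).
    exists c => //; rewrite inE cs; apply/subsetP => x xc.
    have := subsetP sub (f2 x); rewrite imset_f // mem_imset; last exact: sum_inr_inj gK.
    exact.
  case=> c; rewrite inE => /andP[cs sub] ->; split; last exact: imsetS.
  by rewrite inE orbC imset_f.
- move=> _ /imsetP[x _ ->]; exists x, (f2 x); split=> //.
    by rewrite porbit_sum_inr.
  rewrite /orbit_prod porbit_sum_inr card_imset; last exact: sum_inr_inj gK.
  by apply: eq_bigr => k _; rewrite sum_permX_inr.
Qed.

Lemma moment_sum u1 u2 : moment phi a (pp_sum u1 u2) =
  moment phi (a \o f1) u1 * moment phi (a \o f2) u2.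
Proof.
rewrite !ffunE /= pp_sum_part pp_sum_perm.
rewrite (eq_bigl _ _ (fun B => in_setU B _ _)) bigU /=; last first.
  have /eqP := sum_part_disjoint gK (pp_part u2) (pp_partP u1).
  by rewrite setI_eq0.
rewrite !big_imset /=.
- by congr (_ * _); apply: eq_bigr => B _; rewrite ?block_moment_inl ?block_moment_inr.
- by move=> B C _ _; apply: imset_inj; apply: sum_inr_inj gK.
- by move=> B C _ _; apply: imset_inj; apply: sum_inl_inj gK.
Qed.

Lemma cumulant_zeta (T0 : finType) (b : T0 -> A) :
  conv (free_cumulant phi b) pp_zeta = moment phi b.
Proof. exact: conv_mu_zeta. Qed.

(* Free cumulants are multiplicative over unions of blocks because both sides
   have the same convolution with [pp_zeta], namely the moments. *)
Lemma cumulant_sum u1 u2 : free_cumulant phi a (pp_sum u1 u2) =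
  free_cumulant phi (a \o f1) u1 * free_cumulant phi (a \o f2) u2.
Proof.
(* [F] extends the product by 0 outside the unions; the comparison takes place on the set [P] of
   unions, which is closed under left factors. *)
pose F : {ffun partperm T -> R[i]} := [ffun u =>
  if [pick p : partperm T1 * partperm T2 | u == pp_sum p.1 p.2] is Some p
  then free_cumulant phi (a \o f1) p.1 * free_cumulant phi (a \o f2) p.2 else 0].
have FE v1 v2 : F (pp_sum v1 v2) =
    free_cumulant phi (a \o f1) v1 * free_cumulant phi (a \o f2) v2.
  rewrite ffunE; case: pickP => [[w1 w2] /eqP e|/(_ (v1, v2))]; last first.
    by rewrite eqxx.
  by have [-> ->] := pp_sum_inj e.
pose P u := [exists p : partperm T1 * partperm T2, u == pp_sum p.1 p.2].
rewrite -FE; apply: (conv_zeta_eq_on (F := P)) => [u v w vw|u|]; last first.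
- by apply/existsP; exists (u1, u2).
- case/existsP=> -[v1 v2] /eqP -> /=; rewrite cumulant_zeta moment_sum.
  by rewrite (conv_sum FE (@zeta_sum _ _ _ _ _ gK hK _)) !cumulant_zeta.
- case/existsP=> -[v1 v2] /eqP eu; rewrite eu in vw.
  have [[w1 [w2 ->]] _] := pp_mul_sum_split vw.
  by apply/existsP; exists (w1, w2).
Qed.

End SumMoment.

(** * Splitting a point *)

Section Transpositions.
Variable T : finType.
Implicit Types (V W : {set {set T}}) (x y : T) (s : {perm T}).

Lemma pleq_nblk_eq V W : partition V [set: T] -> partition W [set: T] ->
  pleq V W -> (nblk V <= nblk W)%N -> V = W.
Proof.
move=> pV pW VW le; apply: pleq_antisym => // x y xy; apply/negPn/negP => nxy.
have := card_merge x y pV; rewrite nxy.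
have /(pleq_card (pjoin_partition _ _) pW) :
    pleq (pjoin V (porbits (tperm x y))) W.
  by apply: pjoin_lub => //; apply/pleq_tperm.
rewrite /=; nblk_lia.
Qed.

Lemma nblk_tpermr s x y : x != y -> y \notin porbit s x ->
  (nblk (porbits (s * tperm x y)%g) + 1 = nblk (porbits s))%N.
Proof.
(* Inversion keeps the cycles and moves the transposition to the side treated by [nblk_tperm]. *)
move=> xy nxy; have -> : (s * tperm x y = (tperm x y * s^-1)^-1)%g.
  by rewrite invMg invgK tpermV.
rewrite porbitsV; have := nblk_tperm s^-1 x y.
rewrite porbitsV porbitV porbit_sym nxy xy /=; nblk_lia.
Qed.

Lemma porbits_mul_tpermr s x y : y \notin porbit s x ->
  porbits (s * tperm x y)%g = pjoin (porbits (tperm x y)) (porbits s).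
Proof.
move=> nxy; have xy : x != y by apply: contraNneq nxy => ->; apply: porbit_id.
apply: pleq_nblk_eq => //.
  refine (proj2 (pleq_porbits _ _) _) => z; rewrite permM.
  apply: (@peq_trans _ _ (s z)).
    by apply: pleq_pjoinr => //; rewrite peq_porbits (mem_porbit _ 1).
  by apply: pleq_pjoinl => //; rewrite peq_porbits (mem_porbit _ 1).
have := card_merge x y (porbits_partition s); rewrite peq_porbits nxy pjoinC /=.
have := nblk_tpermr xy nxy; nblk_lia.
Qed.

Lemma pp_len_tperm x y : x != y -> pp_len (pp_perm_only (tperm x y)) = 1%N.
Proof.
move=> xy; have := pp_len_perm_only (tperm x y).
have := pp_len_perm_only (1 : {perm T}); rewrite -/pp_one pp_len1.
have := @nblk_tpermr 1 x y xy; rewrite porbit_fixed ?perm1 // inE eq_sym mul1g.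
move=> /(_ xy); nblk_lia.
Qed.

(** Merging two blocks adds two to the length and merging two cycles takes one back, so the length
    grows by one, the length of a transposition. *)
Lemma pp_mul_tperm (u : partperm T) x y : ~~ peq (pp_part u) x y ->
  pp_mul (pp_perm_only (tperm x y)) u =
  Some (pp_prod (pp_perm_only (tperm x y)) u).
Proof.
move=> nxy; have xy : x != y by apply: contraNneq nxy => ->; apply: peq_refl.
have no : y \notin porbit (pp_perm u) x.
  by apply: contra nxy; rewrite -peq_porbits => /pp_permP.
apply/eqP/pp_mulP; split=> //.
have := pp_lenE (pp_prod (pp_perm_only (tperm x y)) u); have := pp_lenE u.
rewrite pp_prod_part pp_prod_perm pp_len_tperm // -[pp_part (pp_perm_only _)]/(porbits _).
rewrite -[pp_perm (pp_perm_only _)]/(tperm _ _) pjoinC.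
have := card_merge x y (pp_partP u); rewrite nxy /=.
have := nblk_tpermr xy no; nblk_lia.
Qed.

Lemma pp_perm_onlyM_tperm s x y : y \notin porbit s x ->
  pp_mul (pp_perm_only (tperm x y)) (pp_perm_only s) =
  Some (pp_perm_only (s * tperm x y)%g).
Proof.
move=> nxy; rewrite pp_mul_tperm ?peq_porbits //; congr Some; apply: pp_ext => //.
by rewrite pp_prod_part -[RHS]/(porbits _) porbits_mul_tpermr.
Qed.

End Transpositions.

(** * Adding a point and inserting it into a cycle *)

Section AddPoint.
Variable T : finType.
Implicit Types (x q : T) (s : {perm T}) (u v w : partperm T).

Definition opt_of_sum (z : T + unit) : option T :=
  if z is inl x then Some x else None.
Definition sum_of_opt (z : option T) : T + unit :=
  if z is Some x then inl x else inr tt.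

Lemma opt_of_sumK : cancel opt_of_sum sum_of_opt. Proof. by case=> [x|[]]. Qed.
Lemma sum_of_optK : cancel sum_of_opt opt_of_sum. Proof. by case. Qed.

Definition add_pt u : partperm (option T) :=
  pp_sum opt_of_sumK sum_of_optK u pp_one.

Lemma partperm_unit (u : partperm unit) : u = pp_one.
Proof.
apply: pp_ext; last by apply/permP => -[]; case: (pp_perm u tt); case: (pp_perm _ tt).
by apply: pleq_antisym => // -[] [] _; apply: peq_refl.
Qed.

Lemma add_pt_part u : pp_part (add_pt u) =
  sum_part opt_of_sum (pp_part u) (pp_part (pp_one : partperm unit)).
Proof. by []. Qed.

Lemma add_pt_permS u x : pp_perm (add_pt u) (Some x) = Some (pp_perm u x).
Proof. exact: (sum_perm_inl opt_of_sumK sum_of_optK). Qed.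

Lemma add_pt_permN u : pp_perm (add_pt u) None = None.
Proof. exact: (sum_perm_inr opt_of_sumK sum_of_optK _ _ tt). Qed.

Lemma add_pt_peqS u x y :
  peq (pp_part (add_pt u)) (Some x) (Some y) = peq (pp_part u) x y.
Proof. exact: (peq_sum_inl opt_of_sumK sum_of_optK (pp_partP u) (pp_partP _)). Qed.

Lemma add_pt_peqN u x : peq (pp_part (add_pt u)) None (Some x) = false.
Proof.
exact: (peq_sum_inrl opt_of_sumK sum_of_optK (pp_partP u) (pp_partP _) tt x).
Qed.

Lemma add_pt_inj : injective add_pt.
Proof. by move=> u v /pp_sum_inj[]. Qed.

Lemma pp_prod_add_pt u v : pp_prod (add_pt u) (add_pt v) = add_pt (pp_prod u v).
Proof. by rewrite pp_prod_sum pp_prod1u. Qed.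

Lemma pp_mul_add_pt u v w :
  (pp_mul (add_pt u) (add_pt v) == Some (add_pt w)) = (pp_mul u v == Some w).
Proof. by rewrite pp_mul_sum pp_mul1u eqxx andbT. Qed.

Lemma add_pt_split (v : partperm (option T)) :
  (forall x, ~~ peq (pp_part v) None (Some x)) -> exists u, v = add_pt u.
Proof.
move=> nv.
have [] := @pp_sum_split _ _ _ _ _ opt_of_sumK sum_of_optK v _ _
  (top_part_partition T) (top_part_partition unit); last first.
  by move=> u [u2 ->]; exists u; rewrite (partperm_unit u2).
move=> a b ab.
have [eL eR] := (peq_sum_inl opt_of_sumK sum_of_optK (top_part_partition T)
  (top_part_partition unit), peq_sum_inr opt_of_sumK sum_of_optK
  (top_part_partition T) (top_part_partition unit)).
case: a b ab => [x|] [y|] ab.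
- exact: etrans (eL x y) (top_part_peq x y).
- by have := nv x; rewrite peq_sym ab.
- by have := nv y; rewrite ab.
- exact: etrans (eR tt tt) (top_part_peq tt tt).
Qed.

Section Split.
Variable q : T.

(* Inserts the new point into the cycle of [q], right before [q]. *)
Definition split_pt u : partperm (option T) :=
  pp_prod (pp_perm_only (tperm None (Some q))) (add_pt u).

Lemma pp_mul_split_pt u :
  pp_mul (pp_perm_only (tperm None (Some q))) (add_pt u) = Some (split_pt u).
Proof. by rewrite pp_mul_tperm // add_pt_peqN. Qed.

Lemma split_pt_perm u :
  pp_perm (split_pt u) = (pp_perm (add_pt u) * tperm None (Some q))%g.
Proof. by []. Qed.

Lemma split_pt_permN u : pp_perm (split_pt u) None = Some q.
Proof. by rewrite split_pt_perm permM add_pt_permN tpermL. Qed.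

Lemma split_pt_peq u a b :
  peq (pp_part (split_pt u)) a b = peq (pp_part u) (odflt q a) (odflt q b).
Proof.
have nq : peq (pp_part (split_pt u)) None (Some q).
  by apply/pleq_tperm; apply: pleq_pjoinl.
have toS c : peq (pp_part (split_pt u)) c (Some (odflt q c)).
  by case: c => [x|]; rewrite ?peq_refl.
apply/idP/idP => [|ab].
  rewrite [peq (pp_part u) _ _]peqE => h; apply/eqP; move: a b h.
  apply: pjoin_invariant => //.
    apply: porbits_invariant => c.
    by case: tpermP => [->|->|].
  move=> a b; case: a b => [x|] [y|] //=.
  - by rewrite add_pt_peqS peqE => /eqP.
  - by rewrite peq_sym add_pt_peqN.
  - by rewrite add_pt_peqN.
apply: peq_trans (toS a) _; rewrite peq_sym; apply: peq_trans (toS b) _.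
by rewrite peq_sym; apply: pleq_pjoinr; rewrite ?add_pt_peqS.
Qed.

Lemma split_pt_inj : injective split_pt.
Proof.
move=> u v e; apply: pp_ext.
  apply: pleq_antisym => // x y.
    by have := split_pt_peq u (Some x) (Some y); rewrite e split_pt_peq => ->.
  by have := split_pt_peq u (Some x) (Some y); rewrite e split_pt_peq => ->.
have /mulIg/permP e2 : (pp_perm (add_pt u) * tperm None (Some q) =
    pp_perm (add_pt v) * tperm None (Some q))%g.
  by rewrite -!split_pt_perm e.
by apply/permP => x; have := e2 (Some x); rewrite !add_pt_permS => -[].
Qed.

Lemma pp_mul_split_ptl u v w : pp_mul v w == Some u ->
  pp_mul (split_pt v) (add_pt w) == Some (split_pt u).
Proof.
move=> vw; have := pp_mulA (pp_perm_only (tperm None (Some q))) (add_pt v) (add_pt w).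
have /eqP-> : pp_mul (add_pt v) (add_pt w) == Some (add_pt u).
  by rewrite pp_mul_add_pt.
by rewrite pp_mul_split_pt /= pp_mul_split_pt /= => <-.
Qed.

Lemma split_pt_surj (v' : partperm (option T)) :
  pp_perm v' None = Some q -> exists v, v' = split_pt v.
Proof.
move=> vN; have nq : peq (pp_part v') None (Some q) by rewrite -vN pp_peq.
have toS c : peq (pp_part v') c (Some (odflt q c)).
  by case: c => [x|]; rewrite ?peq_refl.
(* Multiplying by the transposition once more makes [None] a fixed point, which can then be
   dropped. *)
pose s := (pp_perm v' * tperm None (Some q))%g.
have sN : s None = None by rewrite permM vN tpermR.
have exS x : exists y, s (Some x) == Some y.
  case E : (s (Some x)) => [y|]; first by exists y.
  by have := perm_inj (etrans E (esym sN)).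
pose k x := xchoose (exS x).
have kP x : s (Some x) = Some (k x) by apply/eqP/(xchooseP (exS x)).
have ki : injective k.
  by move=> x y e'; apply: Some_inj; apply: (@perm_inj _ s); rewrite !kP e'.
have ppv : is_partperm (kpart (fun x => pblock (pp_part v') (Some x)), perm ki).
  apply: is_partpermP => //; apply/pleq_porbits => x.
  rewrite peq_kpart permE -kP -peqE; apply: peq_trans (pp_peq v' _) _.
  by rewrite permM; case: tpermP => [->|->|_ _]; rewrite ?peq_refl // peq_sym.
pose v : partperm T := Sub _ ppv; exists v; apply: pp_ext.
  have sp a b : peq (pp_part v') a b = peq (pp_part (split_pt v)) a b.
    rewrite split_pt_peq -[pp_part v]/(kpart _) peq_kpart -peqE.
    apply/idP/idP => [ab|ab].
      apply: peq_trans (toS b); apply: peq_trans ab.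
      by rewrite peq_sym toS.
    apply: peq_trans (toS a) _; apply: peq_trans ab _.
    by rewrite peq_sym toS.
  by apply: pleq_antisym => // a b; rewrite sp.
rewrite split_pt_perm; have -> : pp_perm (add_pt v) = s.
  apply/permP => -[x|]; last by rewrite add_pt_permN sN.
  by rewrite add_pt_permS kP -[pp_perm v]/(perm ki) permE.
by rewrite /s -mulgA tperm2 mulg1.
Qed.

(** As [add_pt w] fixes [None], the left factor sends [None] to [Some q] like the product, so it is
    itself a split; associativity and injectivity then cancel the transposition. *)
Lemma split_pt_cancel u (v' : partperm (option T)) w :
  pp_mul v' (add_pt w) == Some (split_pt u) ->
  exists2 v, v' = split_pt v & pp_mul v w == Some u.
Proof.
move=> m; have [e _] := pp_mulP _ _ _ m.
have eP := congr1 (@pp_perm _) e; rewrite pp_prod_perm in eP.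
have [|v ev] := @split_pt_surj v'.
  by have := split_pt_permN u; rewrite -eP permM add_pt_permN.
exists v => //; move: m; rewrite ev.
have := pp_mulA (pp_perm_only (tperm None (Some q))) (add_pt v) (add_pt w).
rewrite pp_mul_split_pt /= => <-; case E : pp_mul => [x|] //= /eqP.
have [ex _] := pp_mulP _ _ _ (introT eqP E).
rewrite pp_prod_add_pt in ex; rewrite -ex pp_mul_split_pt => /Some_inj/split_pt_inj eu.
by rewrite -pp_mul_add_pt E -ex eu.
Qed.

End Split.
End AddPoint.

(** * Cumulants with a product as entry *)

Section SplitMoment.
Variables (R : realType) (A : algType R[i]) (phi : seq A -> R[i]).
Hypothesis hphi : is_hops phi.
Variables (T : finType) (q : T).
Implicit Types (u : partperm T) (s : {perm T}) (x : T) (B : {set T}).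

Definition split_block B : {set option T} := [set a | odflt q a \in B].

Lemma split_block_inj : injective split_block.
Proof.
by move=> B C /setP e; apply/setP => x; have := e (Some x); rewrite !inE.
Qed.

Lemma split_blockS B C : (split_block B \subset split_block C) = (B \subset C).
Proof.
apply/subsetP/subsetP => sub x; last by rewrite !inE; apply: sub.
by have := sub (Some x); rewrite !inE.
Qed.

Lemma pblock_split_pt u a :
  pblock (pp_part (split_pt q u)) a = split_block (pblock (pp_part u) (odflt q a)).
Proof.
by apply/setP => b; rewrite -peq_mem // split_pt_peq inE -peq_mem.
Qed.

Lemma split_pt_part u : pp_part (split_pt q u) = split_block @: pp_part u.
Proof.
rewrite [LHS](part_image (pp_partP _)) [in RHS](part_image (pp_partP u)).
apply/setP => C.
apply/imsetP/imsetP => [[a _ ->]|[_ /imsetP[x _ ->] ->]].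
  exists (pblock (pp_part u) (odflt q a)); last exact: pblock_split_pt.
  exact: imset_f.
by exists (Some x) => //; rewrite pblock_split_pt.
Qed.

Lemma split_pt_perm_only s : pp_part (split_pt q (pp_perm_only s)) =
  porbits (pp_perm (split_pt q (pp_perm_only s))).
Proof.
rewrite split_pt_perm porbits_mul_tpermr.
  rewrite pp_prod_part; congr pjoin; rewrite add_pt_part.
  by symmetry; apply: porbits_sum.
apply/negP; rewrite -peq_porbits => /pp_permP; by rewrite add_pt_peqN.
Qed.

(** The permutation of [split_pt q u] depends only on that of [u], so [u] may be replaced by
    [pp_perm_only], for which blocks are cycles. *)
Lemma porbits_split_pt u :
  porbits (pp_perm (split_pt q u)) = split_block @: porbits (pp_perm u).
Proof.
transitivity (porbits (pp_perm (split_pt q (pp_perm_only (pp_perm u))))) => //.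
by rewrite -split_pt_perm_only split_pt_part.
Qed.

Lemma porbit_split_pt u a : porbit (pp_perm (split_pt q u)) a =
  split_block (porbit (pp_perm u) (odflt q a)).
Proof.
transitivity (porbit (pp_perm (split_pt q (pp_perm_only (pp_perm u)))) a) => //.
rewrite -pblock_porbits -split_pt_perm_only pblock_split_pt.
by rewrite -[pp_part _]/(porbits (pp_perm u)) pblock_porbits.
Qed.

Lemma split_pt_permX u x k :
  (forall i, (0 < i <= k)%N -> (pp_perm u ^+ i)%g x != q) ->
  (pp_perm (split_pt q u) ^+ k)%g (Some x) = Some ((pp_perm u ^+ k)%g x).
Proof.
elim: k => [|k IH] nq; first by rewrite !expg0 !perm1.
rewrite expgSr permM IH; last first.
  by move=> i /andP[i0 ik]; apply: nq; rewrite i0 ltnW.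
have := nq k.+1 (leqnn _); rewrite expgSr permM => nq1.
by rewrite split_pt_perm permM add_pt_permS tpermD // eq_sym.
Qed.

Lemma card_split_block B : #|split_block B| = (#|B| + (q \in B))%N.
Proof.
have -> : split_block B = [set a | (a == None) && (q \in B)] :|: Some @: B.
  apply/setP => -[x|]; rewrite !inE /=.
    by rewrite mem_imset //; exact: Some_inj.
  by apply/idP/orP => [->|[//|/imsetP[//]]]; left.
rewrite cardsU (_ : _ :&: _ = set0) ?cards0 ?subn0; last first.
  by apply/setP => -[x|]; rewrite !inE //=; apply/negP => /andP[_ /imsetP[]].
rewrite addnC card_imset; last exact: Some_inj.
congr (_ + _)%N; case: (q \in B).
  by rewrite (_ : [set a | _] = [set None]) ?cards1 //; apply/setP => a; rewrite !inE andbT.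
by rewrite (_ : [set a | _] = set0) ?cards0 //; apply/setP => a; rewrite !inE andbF.
Qed.

Lemma permX_neq s x i : (0 < i < #|porbit s x|)%N -> (s ^+ i)%g x != x.
Proof.
case/andP=> i0 lt; apply/eqP => e; have := uniq_traject_porbit s x.
have n0 : (0 < #|porbit s x|)%N by apply: leq_trans lt.
move/(nth_uniq x)=> /(_ 0 i); rewrite size_traject n0 lt => /(_ isT isT).
by rewrite !nth_traject //= -permX e eqxx => /esym/eqP i0'; rewrite -i0' in i0.
Qed.

Variables (a : T -> A) (a' : option T -> A).
Hypothesis aq : a q = a' None * a' (Some q).
Hypothesis ax : forall x, x != q -> a x = a' (Some x).

Lemma orbit_prod_split u c : c \in porbits (pp_perm u) -> exists x y,
  [/\ c = porbit (pp_perm u) x,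
      split_block c = porbit (pp_perm (split_pt q u)) y &
      orbit_prod a (pp_perm u) x = orbit_prod a' (pp_perm (split_pt q u)) y].
Proof.
set s := pp_perm u; set s' := pp_perm _.
have [qc|qc] := boolP (q \in c) => /imsetP[x _ ec]; rewrite ec in qc *; last first.
  exists x, (Some x); rewrite porbit_split_pt; split=> //.
  rewrite /orbit_prod porbit_split_pt card_split_block (negPf qc) addn0.
  have nq i : (s ^+ i)%g x != q.
    by apply: contraNneq qc => <-; apply: mem_porbit.
  by apply: eq_bigr => k _; rewrite split_pt_permX // ax.
have -> : porbit s x = porbit s q by apply/esym/eqP; rewrite eq_porbit_mem.
(* The new point is followed by [q], so the product read from [None] begins with
   [a' None * a' (Some q)]. *)
exists q, None; rewrite porbit_split_pt; split=> //.
rewrite /orbit_prod porbit_split_pt card_split_block porbit_id addn1.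
have := @permX_neq s q.
have : (0 < #|porbit s q|)%N by rewrite lt0n card_porbit_neq0.
case: #|porbit s q| => // n _ nq.
rewrite [RHS]big_ord_recl /= expg0 perm1.
under [X in _ * X]eq_bigr => k _ do
  rewrite -[bump 0 k]/(k.+1) expgS permM split_pt_permN.
rewrite !big_ord_recl /= !expg0 !perm1 aq mulrA; congr (_ * _).
apply: eq_bigr => k _; have lk := ltn_ord k.
rewrite -[bump 0 k]/(k.+1) ax; last by apply: nq.
rewrite split_pt_permX // => i /andP[i0 ik]; apply: nq.
by rewrite i0; apply: leq_ltn_trans ik _.
Qed.

Lemma moment_split u : moment phi a u = moment phi a' (split_pt q u).
Proof.
rewrite !ffunE split_pt_part big_imset /=; last first.
  by move=> B C _ _; apply: split_block_inj.
apply: eq_bigr => B _.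
apply: (block_moment_transfer hphi split_block_inj); last exact: orbit_prod_split.
rewrite porbits_split_pt; apply/setP => C; rewrite inE.
apply/andP/imsetP => [[/imsetP[c cs ->]]|[c]].
  by rewrite split_blockS => sub; exists c; rewrite // inE cs.
by rewrite inE => /andP[cs sub] ->; rewrite imset_f ?split_blockS.
Qed.

End SplitMoment.

(** * Factorization of the zeta function *)

Section ZetaFactor.
Variables (K : nzRingType) (T : finType).
Implicit Types (v w u : partperm (option T)).

(** The case [k = None] is the identity, so this is [pp_delta] plus the transpositions that move
    [None]. *)
Definition zeta_star : {ffun partperm (option T) -> K} :=
  [ffun w => [exists k, w == pp_perm_only (tperm None k)]%:R].

Definition zeta_fix : {ffun partperm (option T) -> K} :=
  [ffun w => pp_zeta w * (pp_perm w None == None)%:R].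

(* A permutation [s] factors uniquely as the transposition of [None] and
   [s None] following a permutation fixing [None], and the lengths add up. *)
Lemma zeta_factor : conv zeta_star zeta_fix = pp_zeta.
Proof.
apply/ffunP => u; rewrite [LHS]ffunE big_mkcond /=.
pose s := pp_perm u; pose k := s None; pose s0 := (s * tperm None k)%g.
have es : s = (s0 * tperm None k)%g by rewrite /s0 -mulgA tperm2 mulg1.
have s0N : s0 None = None by rewrite permM -/k tpermR.
pose p0 := (pp_perm_only (tperm None k), pp_perm_only s0).
have m0 : pp_mul p0.1 p0.2 = Some (pp_perm_only s).
  have [k0|nk] := eqVneq k None; rewrite /p0 /=.
    by rewrite es k0 tperm1 mulg1 -/pp_one pp_mul1u.
  by rewrite pp_perm_onlyM_tperm -?es // porbit_fixed // inE.
rewrite (bigD1 p0) //= [X in _ + X]big1 ?addr0.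
  rewrite m0 [zeta_star _]ffunE [zeta_fix _]ffunE !pp_zetaE.
  have -> : [exists k0, p0.1 == pp_perm_only (tperm None k0)].
    by apply/existsP; exists k.
  rewrite -[pp_perm p0.2]/s0 s0N !eqxx !mulr1.
  rewrite -/s; case: eqP => [[->]|ne]; first by rewrite eqxx.
  by case: eqP => // e; case: ne; rewrite -e.
move=> [v w] np; rewrite [zeta_star _]ffunE [zeta_fix _]ffunE pp_zetaE /=.
case: ifP => // m.
case: existsP => [[k' /eqP ev]|_]; last by rewrite mul0r.
case: eqP => [ew|_]; last by rewrite !mul0r mulr0.
case: eqP => [wN|_]; last by rewrite !mulr0.
case/eqP: np; have [e _] := pp_mulP _ _ _ m.
have := congr1 (@pp_perm _) e; rewrite pp_prod_perm -/s ev.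
rewrite -[pp_perm (pp_perm_only _)]/(tperm None k') => e2.
have ek : k = k' by rewrite /k -e2 permM wN tpermL.
rewrite /p0 -ek; congr (_, _); apply: pp_ext; last first.
  by rewrite -[RHS]/s0 /s0 -e2 -ek -mulgA tperm2 mulg1.
rewrite ew -[RHS]/(porbits s0); congr porbits.
by rewrite /s0 -e2 -ek -mulgA tperm2 mulg1.
Qed.

Lemma zeta_fix_add_pt (w : partperm T) : zeta_fix (add_pt w) = pp_zeta w.
Proof.
rewrite ffunE add_pt_permN eqxx mulr1 zeta_sum.
have -> : pp_zeta (pp_one : partperm unit) = 1 :> K.
  by rewrite pp_zetaE; case: eqP => // -[]; apply: partperm_unit.
by rewrite mulr1.
Qed.

Lemma zeta_fix_supp w : zeta_fix w != 0 -> exists w0 : partperm T, w = add_pt w0.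
Proof.
rewrite ffunE pp_zetaE -natrM mulnb; case: andP => [[/eqP ew /eqP wN] _|]; last first.
  by rewrite eqxx.
apply: add_pt_split => x; rewrite ew -[pp_part _]/(porbits _) peq_porbits.
by rewrite porbit_fixed // inE.
Qed.

End ZetaFactor.

Section ProductFormula.
Variables (R : realType) (A : algType R[i]) (phi : seq A -> R[i]).
Hypothesis hphi : is_hops phi.
Variables (T : finType) (q : T) (a : T -> A) (a' : option T -> A).
Hypothesis aq : a q = a' None * a' (Some q).
Hypothesis ax : forall x, x != q -> a x = a' (Some x).

Lemma cumulant_product u : free_cumulant phi a u =
  conv (free_cumulant phi a') (zeta_star _ T) (split_pt q u).
Proof.
set K := conv _ _; pose F : {ffun partperm T -> R[i]} := [ffun u => K (split_pt q u)].
suff e : moment phi a = conv F pp_zeta.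
  by rewrite /free_cumulant e conv_zeta_mu ffunE.
apply/ffunP => {}u; rewrite (moment_split hphi aq ax).
rewrite -cumulant_zeta -(zeta_factor _ T) convA -/K !ffunE.
pose k (p : partperm T * partperm T) := (split_pt q p.1, add_pt p.2).
have ki : injective k.
  move=> [v w] [v' w'] e; have /= /split_pt_inj-> := congr1 fst e.
  by have /= /add_pt_inj-> := congr1 snd e.
pose B := [set p : partperm T * partperm T | pp_mul p.1 p.2 == Some u].
(* Only right factors of the form [add_pt w] survive in [zeta_fix]; by [split_pt_cancel] the
   factorizations left over are the images under [k] of those of [u]. *)
rewrite (bigID (mem (k @: B))) /= [X in _ + X]big1 ?addr0; last first.
  move=> [v' w'] /= /andP[m nB]; have [->|/zeta_fix_supp[w ew]] :=
    eqVneq (zeta_fix R[i] T w') 0; first by rewrite mulr0.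
  rewrite ew in m nB; have [v ev vw] := split_pt_cancel m.
  by case/imsetP: nB; exists (v, w); rewrite ?inE // /k /= ev.
transitivity (\sum_(p in k @: B) K p.1 * zeta_fix R[i] T p.2).
  apply: eq_bigl => p; apply/andP/idP => [[]//|pB]; split=> //.
  case/imsetP: pB => -[v w]; rewrite inE /= => vw ->.
  exact: pp_mul_split_ptl.
rewrite big_imset /=; last by move=> p p' _ _; apply: ki.
apply: eq_big => [p|[v w] _]; first by rewrite inE.
by rewrite zeta_fix_add_pt [F _]ffunE.
Qed.

End ProductFormula.

(** * Linearity and change of index set *)

Section MomentFacts.
Variables (R : realType) (A : algType R[i]) (phi : seq A -> R[i]).
Hypothesis hphi : is_hops phi.
Variable T : finType.
Implicit Types (u v w : partperm T) (s : {perm T}) (x p : T) (a : T -> A).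

Lemma eq_block_moment a b s (V : {set T}) : {in V, a =1 b} ->
  block_moment phi a s V = block_moment phi b s V.
Proof.
move=> ab; rewrite /block_moment; congr phi; apply/eq_in_map => c.
rewrite mem_enum inE => /andP[/imsetP[x _ ec] sub].
rewrite /cycle_prod; case: pickP => // y yc; apply: eq_bigr => k _.
apply/ab/(subsetP sub); move: {k}(val k) => k; move: yc; rewrite ec => yx.
have /eqP <- : porbit s y == porbit s x by rewrite eq_porbit_mem.
exact: mem_porbit.
Qed.

Lemma block_moment_pull a s (V : {set T}) p : porbit s p \subset V ->
  block_moment phi a s V =
  phi (orbit_prod a s p ::
       [seq cycle_prod a s c | c <- rem (porbit s p)
          (enum [set c in porbits s | c \subset V])]).
Proof.
move=> sub; rewrite /block_moment; set r := enum _.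
have pr : porbit s p \in r by rewrite mem_enum inE imset_f.
rewrite (hops_symmetric hphi (perm_map _ (perm_to_rem pr))) /=.
have [b [c [-> ->]]] := cycle_prod_conj a s p.
exact: (hops_tracial hphi [::]).
Qed.

(** The fixed point [p] is not the only cycle of its block, so the block contributes a value of
    [phi] on at least two arguments, one of which is 1. *)
Lemma moment_unit0 a u p x : a p = 1 -> pp_perm u p = p -> x != p ->
  peq (pp_part u) p x -> moment phi a u = 0.
Proof.
move=> ap up xp px; rewrite ffunE; set s := pp_perm u in up *.
have V0 := pblock_in p (pp_partP u).
rewrite (bigD1 _ V0) /= (@block_moment_pull _ _ _ p); last first.
  by rewrite porbit_fixed // sub1set pblock_id.
rewrite {1}/orbit_prod porbit_fixed // cards1 big_ord1 expg0 perm1 ap.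
rewrite (hops_unit_cumul hphi) ?mul0r // size_map.
have : porbit s x \in rem [set p] (enum [set c in porbits s | c \subset pblock (pp_part u) p]).
  rewrite (rem_filter _ (enum_uniq _)) mem_filter /= mem_enum inE imset_f //.
  rewrite andTb; apply/andP; split.
    apply: contraNneq xp => e; have := porbit_id s x.
    by rewrite e inE.
  apply/subsetP => y; rewrite -peq_porbits => /pp_permP xy.
  by rewrite -peq_mem //; apply: peq_trans px xy.
by case: (rem _ _).
Qed.

Definition upd a p y : T -> A := fun x => if x == p then y else a x.

(** The cycle of [p] is moved to the front and read from [p], so the changed entry is the leftmost
    factor of the first argument; [Q] and [r] do not depend on [y]. *)
Lemma block_moment_upd a s p (V : {set T}) : porbit s p \subset V ->
  exists (Q : A) (r : seq A), forall y, block_moment phi (upd a p y) s V =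
    phi ((y * Q) :: r).
Proof.
move=> sub; exists (\prod_(1 <= k < #|porbit s p|) a ((s ^+ k)%g p)).
exists [seq cycle_prod a s c | c <- rem (porbit s p)
          (enum [set c in porbits s | c \subset V])] => y.
rewrite (block_moment_pull _ sub); congr (phi (_ :: _)).
  rewrite /orbit_prod -(big_mkord predT (fun k => upd a p y ((s ^+ k)%g p))).
  have n0 : (0 < #|porbit s p|)%N by rewrite lt0n card_porbit_neq0.
  rewrite (big_ltn n0) expg0 perm1 {1}/upd eqxx; congr (_ * _).
  apply: eq_big_nat => k kn; rewrite /upd; case: eqP => // e.
  by have := permX_neq kn; rewrite e eqxx.
apply/eq_in_map => c; rewrite (rem_filter _ (enum_uniq _)) mem_filter /=.
rewrite mem_enum inE => /and3P[nc /imsetP[x _ ec] _].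
rewrite /cycle_prod; case: pickP => // z zc; apply: eq_bigr => k _.
rewrite /upd; case: eqP => // e; case/eqP: nc; rewrite -e porbit_perm ec.
by apply/esym/eqP; rewrite eq_porbit_mem -ec.
Qed.

Lemma moment_linear a p u (c : R[i]) y z :
  moment phi (upd a p (c *: y + z)) u =
  c * moment phi (upd a p y) u + moment phi (upd a p z) u.
Proof.
rewrite !ffunE; have V0 := pblock_in p (pp_partP u).
rewrite !(bigD1 _ V0) /=.
have sub : porbit (pp_perm u) p \subset pblock (pp_part u) p.
  by apply/subsetP => x; rewrite -peq_porbits -peq_mem // => /pp_permP.
have [Q [r E]] := block_moment_upd a sub; rewrite !E mulrDl -scalerAl.
rewrite (hops_linear hphi [::]) /= mulrDl -mulrA.
have eqV y1 y2 : \prod_(V in pp_part u | V != pblock (pp_part u) p)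
    block_moment phi (upd a p y1) (pp_perm u) V =
  \prod_(V in pp_part u | V != pblock (pp_part u) p)
    block_moment phi (upd a p y2) (pp_perm u) V.
  apply: eq_bigr => V /andP[Vu nV]; apply: eq_block_moment => x xV.
  rewrite /upd; case: eqP => // e; case/eqP: nV; rewrite -e.
  have [_ t _] := and3P (pp_partP u); exact/esym/def_pblock.
by rewrite (eqV (c *: y + z) y) [in LHS](eqV y z) (eqV y z).
Qed.

Lemma cumulant_linear a p u (c : R[i]) y z :
  free_cumulant phi (upd a p (c *: y + z)) u =
  c * free_cumulant phi (upd a p y) u + free_cumulant phi (upd a p z) u.
Proof.
rewrite /free_cumulant ![conv _ _ _]ffunE mulr_sumr -big_split /=.
by apply: eq_bigr => q _; rewrite moment_linear mulrDl mulrA.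
Qed.

Lemma upd_id a p : upd a p (a p) = a.
Proof. by apply: funext => x; rewrite /upd; case: eqP => [->|]. Qed.

(** Serves index sets with one point or none. *)
Lemma cumulant_trivial a : (forall u, u = pp_one) ->
  free_cumulant phi a pp_one = moment phi a pp_one.
Proof.
move=> triv; rewrite -cumulant_zeta [RHS]convE (bigD1 pp_one) //= [X in _ + X]big1 ?addr0.
  rewrite (bigD1 pp_one) //= [X in _ + X]big1 ?addr0.
    by rewrite pp_mul1u eqxx pp_zetaE eqxx mulr1.
  by move=> w; rewrite (triv w) eqxx.
by move=> w; rewrite (triv w) eqxx.
Qed.

End MomentFacts.

(** * Relabelling and restriction to a block *)

Section TypeChange.
Variables (R : realType) (A : algType R[i]) (phi : seq A -> R[i]).
Hypothesis hphi : is_hops phi.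

Lemma cumulant_unit (a : unit -> A) : a tt = 1 ->
  free_cumulant phi a pp_one = 1.
Proof.
move=> a1; rewrite cumulant_trivial; last exact: partperm_unit.
have e : pp_part (pp_one : partperm unit) = [set [set tt]].
  rewrite [LHS]porbits1; apply/setP => B; rewrite inE; apply/imsetP/eqP.
    by case=> -[] _ ->.
  by move=> ->; exists tt.
rewrite ffunE e big_set1 (block_moment_pull hphi a (p := tt)); last first.
  by rewrite porbit_fixed // perm1.
rewrite /orbit_prod porbit_fixed ?perm1 // cards1 big_ord1 expg0 perm1 a1.
rewrite (_ : rem _ _ = [::]) /= ?(hops_unit hphi) //.
apply/eqP; rewrite -size_eq0 size_rem; last first.
  by rewrite mem_enum !inE subxx andbT /porbits -[[set tt]](@porbit_fixed _ 1%g) ?perm1 // imset_f.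
rewrite -cardE -subn1 subn_eq0; apply: (@leq_trans #|porbits (1%g : {perm unit})|).
  by apply: subset_leq_card; apply/subsetP => c; rewrite inE => /andP[].
by have := part_card_le (porbits_partition (1%g : {perm unit})); rewrite nblkE nptsE card_unit.
Qed.

Lemma cumulant_void (a : void -> A) u : free_cumulant phi a u = 1.
Proof.
have triv (v : partperm void) : v = pp_one.
  by apply: pp_ext; [apply: pleq_antisym => // -[]|apply/permP => -[]].
rewrite (triv u) cumulant_trivial // ffunE big1 // => V /(in_partP (pp_partP _)).
by case=> -[].
Qed.

Lemma cumulant_add_pt (T : finType) (a : option T -> A) u : a None = 1 ->
  free_cumulant phi a (add_pt u) = free_cumulant phi (a \o Some) u.
Proof. by move=> a1; rewrite cumulant_sum // cumulant_unit // mulr1. Qed.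

Lemma cumulant_bij (T T' : finType) (f : T' -> T) (f' : T -> T')
    (a : T -> A) (u : partperm T) : cancel f f' -> cancel f' f ->
  exists2 u' : partperm T',
    (forall x y, peq (pp_part u') x y = peq (pp_part u) (f x) (f y)) &
    free_cumulant phi a u = free_cumulant phi (a \o f) u'.
Proof.
move=> fK f'K.
pose g (z : T' + void) : T := match z with inl x => f x | inr y => match y with end end.
pose h (z : T) : T' + void := inl (f' z).
have gK : cancel g h by move=> [x|[]]; rewrite /g /h fK.
have hK : cancel h g by move=> x; rewrite /g /h f'K.
have [|v1 [v2 e]] := @pp_sum_split _ _ _ _ _ gK hK u _ _
  (top_part_partition T') (top_part_partition void).
  move=> x y _; rewrite -(f'K x) -(f'K y).
  exact: etrans (peq_sum_inl gK hK (top_part_partition _)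
    (top_part_partition _) (f' x) (f' y)) (top_part_peq _ _).
exists v1; rewrite e.
  by move=> x y; rewrite -(peq_sum_inl gK hK (pp_partP v1) (pp_partP v2)).
by rewrite (cumulant_sum hphi) cumulant_void mulr1.
Qed.

(** The block of [p] is separated from its complement. The other factor stays anonymous as [c],
    because the lemma serves to derive vanishing from that of one block. *)
Lemma cumulant_block (T : finType) (a : T -> A) (u : partperm T) (p : T) :
  exists (s : {perm {x : T | peq (pp_part u) p x}}) (c : R[i]),
    free_cumulant phi a u = free_cumulant phi (a \o val) (pp_top s) * c.
Proof.
pose T1 := {x : T | peq (pp_part u) p x}.
pose T2 := {x : T | ~~ peq (pp_part u) p x}.
pose g (z : T1 + T2) : T := match z with inl x => val x | inr y => val y end.
pose h (z : T) : T1 + T2 :=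
  match pselect (peq (pp_part u) p z) with
  | left e => inl (exist _ z e) | right e => inr (exist _ z (introN idP e)) end.
have hK : cancel h g by move=> x; rewrite /h; case: pselect.
have gK : cancel g h.
  case=> [[x px]|[x px]]; rewrite /g /h /=; case: pselect => e.
  - by congr inl; apply: val_inj.
  - by case: e.
  - by case/negP: px.
  - by congr inr; apply: val_inj.
have [x y xy|v1 [v2 e]] := @pp_sum_split _ _ _ _ _ gK hK u _ _
  (top_part_partition T1) (top_part_partition T2).
  rewrite -(hK x) -(hK y) /h; case: pselect => px; case: pselect => py.
  - exact: etrans (peq_sum_inl gK hK (top_part_partition _)
      (top_part_partition _) (exist _ x px) (exist _ y py)) (top_part_peq _ _).
  - by case: py; apply: peq_trans px xy.
  - by case: px; apply: peq_trans py _; rewrite peq_sym.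
  - exact: etrans (peq_sum_inr gK hK (top_part_partition _)
      (top_part_partition _) (exist _ x (introN idP px))
      (exist _ y (introN idP py))) (top_part_peq _ _).
exists (pp_perm v1), (free_cumulant phi (a \o sum_inr g) v2).
rewrite {1}e (cumulant_sum hphi); congr (free_cumulant _ _ _ * _).
apply: pp_ext => //; apply: peq_top_part => // -[x px] [y py].
rewrite -(peq_sum_inl gK hK (pp_partP v1) (pp_partP v2)) -(pp_sum_part gK hK) -e.
by rewrite /sum_inl /=; apply: peq_trans py; rewrite peq_sym.
Qed.

End TypeChange.

(** * Freeness of the generated subalgebras *)

Section UnitEntries.
Variables (R : realType) (A : algType R[i]) (phi : seq A -> R[i]).
Hypothesis hphi : is_hops phi.

(** Moving the transposition from the right of [add_pt u] to its left conjugates it, which turns [k]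
    into [pp_perm u k]. *)
Lemma pp_prod_add_pt_tperm (T : finType) (u : partperm T) (k : T) :
  pp_prod (add_pt u) (pp_perm_only (tperm None (Some k))) =
  split_pt (pp_perm u k) u.
Proof.
apply: pp_ext; last first.
  rewrite split_pt_perm pp_prod_perm -[pp_perm (pp_perm_only _)]/(tperm _ _).
  by rewrite [LHS]conjgC tpermJ add_pt_permN add_pt_permS.
have kq := pp_peq u k; rewrite -[LHS]/(pjoin _ _) -[RHS]/(pjoin _ _).
apply: pleq_antisym; [exact: pjoin_partition|exact: pjoin_partition| |].
  apply: pjoin_lub => //; first exact: pleq_pjoinr.
  apply/pleq_tperm; apply: (@peq_trans _ _ (Some (pp_perm u k))).
    by apply: pleq_pjoinl => //; apply/pleq_tperm.
  by apply: pleq_pjoinr => //; rewrite add_pt_peqS peq_sym.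
apply: pjoin_lub => //; last exact: pleq_pjoinl.
apply/pleq_tperm; apply: (@peq_trans _ _ (Some k)).
  by apply: pleq_pjoinr => //; apply/pleq_tperm.
by apply: pleq_pjoinl => //; rewrite add_pt_peqS.
Qed.

Lemma pp_mul_add_pt_tperm (T : finType) (u : partperm T) (k : T) :
  pp_mul (add_pt u) (pp_perm_only (tperm None (Some k))) =
  Some (split_pt (pp_perm u k) u).
Proof.
apply/eqP/pp_mulP; rewrite pp_prod_add_pt_tperm; split=> //.
have /eqP/pp_mulP[_ <-] := pp_mul_split_pt (pp_perm u k) u.
by rewrite !pp_len_tperm // addnC.
Qed.

(* When [None] is not a fixed point, [v] is [split_pt q u], and the product
   formula for [a (Some q) = 1 * a (Some q)] contains, besides the cumulant at
   [v], only the cumulant it computes and shorter ones. *)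
Lemma cumulant_one_option (T : finType) (a : option T -> A)
    (v : partperm (option T)) (x : T) : a None = 1 ->
  peq (pp_part v) None (Some x) -> free_cumulant phi a v = 0.
Proof.
move=> a1; have [m] := ubnP (pp_len v); elim: m v x => // m IH v x lem vx.
(* Proper left factors of [v] fall under the induction hypothesis unless [None] is alone in its
   block, that is, unless they come from [add_pt]. *)
have shorter v1 w : pp_mul v1 w == Some v -> w != pp_one ->
    (0 < pp_len w)%N -> (forall u, v1 <> add_pt u) -> free_cumulant phi a v1 = 0.
  case/pp_mulP=> e l nw w0 nv1.
  have [/existsP[y vy]|/existsPn nv] := boolP [exists y, peq (pp_part v1) None (Some y)].
    by apply: (IH v1 y) => //; move: lem l w0; clear; lia.
  by have [u eu] := add_pt_split nv; case: (nv1 u).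
case vN : (pp_perm v None) => [q|]; last first.
  (* If [v] fixes [None], its moment vanishes, and in the expansion of this moment over left factors
     every term but the cumulant at [v] is zero. *)
  have m0 : moment phi a v = 0 by apply: (moment_unit0 hphi a1 vN) vx.
  move: m0; rewrite -cumulant_zeta convP (bigD1 v) //= [X in _ + X]big1.
    rewrite addr0 (bigD1 pp_one) ?pp_mulu1 //= pp_zetaE eqxx mulr1 big1.
      by rewrite addr0.
    move=> w /andP[/pp_mulP[_ l] nw]; rewrite pp_zetaE; case: eqP => [ew|_].
      case/eqP: nw; rewrite ew; congr pp_perm_only; apply: nblk_porbits_max.
      have := pp_len_perm_only (pp_perm w); rewrite -ew; move: l.
      by move: (pp_len v) (pp_len w) (nblk _) (npts _); clear; lia.
    by rewrite mulr0.
  move=> v1 nv1; apply: big1 => w vw; rewrite pp_zetaE.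
  case: eqP => [ew|_]; last by rewrite mulr0.
  have [w1|nw] := eqVneq w pp_one.
    by move: vw nv1; rewrite w1 pp_mulu1 => /eqP[->]; rewrite eqxx.
  have w0 : (0 < pp_len w)%N.
    rewrite lt0n; apply: contraNneq nw => l0; rewrite ew; apply/eqP.
    congr pp_perm_only; apply: nblk_porbits_max.
    by have := pp_len_perm_only (pp_perm w); rewrite -ew l0.
  rewrite (shorter _ _ vw nw w0) ?mul0r // => u eu.
  have [e _] := pp_mulP _ _ _ vw.
  have wN : pp_perm w None = None.
    apply: (@perm_inj _ (pp_perm v1)); rewrite -permM -pp_prod_perm e vN eu.
    by rewrite add_pt_permN.
  (* Both factors keep [None] apart from the other points, hence so does their join, contrary to
     [vx]. *)
  suff /(_ None (Some x)) H : forall y z, peq (pp_part v) y z ->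
     (y == None) = (z == None) by move: (H vx).
  rewrite -e pp_prod_part; apply: pjoin_invariant; try exact: pp_partP.
    rewrite eu => -[y|] [z|] //; last by rewrite add_pt_peqN.
    by rewrite peq_sym add_pt_peqN.
  rewrite ew; apply: porbits_invariant => z.
  by rewrite -{1}wN (inj_eq (@perm_inj _ _)).
have [u ev] := split_pt_surj vN.
have E : free_cumulant phi (a \o Some) u =
    conv (free_cumulant phi a) (zeta_star _ T) v.
  by rewrite ev; apply: (cumulant_product hphi) => //; rewrite a1 mul1r.
suff E2 : free_cumulant phi (a \o Some) u =
    free_cumulant phi a v + free_cumulant phi (a \o Some) u.
  by move/eqP: E2; rewrite -subr_eq subrr eq_sym => /eqP.
rewrite {1}E [LHS]ffunE.
pose p1 : partperm (option T) * partperm (option T) := (v, pp_one).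
(* With this preimage of [q], the transposition as right factor of [add_pt u] gives [v]; this term
   reproduces the cumulant on the left-hand side. *)
pose k := (pp_perm u)^-1%g q.
pose t : partperm (option T) := pp_perm_only (tperm None (Some k)).
pose p2 : partperm (option T) * partperm (option T) := (add_pt u, t).
have m1 : pp_mul p1.1 p1.2 == Some v by rewrite pp_mulu1.
have m2 : pp_mul p2.1 p2.2 == Some v by rewrite pp_mul_add_pt_tperm permKV ev.
have p21 : p2 != p1.
  apply/eqP => e; have := congr1 (fun p => pp_len p.2) e.
  by rewrite /= pp_len1 pp_len_tperm.
have z1 : zeta_star R[i] T pp_one = 1.
  rewrite ffunE; case: existsP => // -[]; exists None.
  by rewrite tperm1.
have zk k0 : zeta_star R[i] T (pp_perm_only (tperm None k0)) = 1.
  by rewrite ffunE; case: existsP => // -[]; exists k0.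
rewrite (bigD1 p1) // (bigD1 p2) /=; last by rewrite m2 p21.
rewrite big1 ?addr0 => [|[v1 w] /= /andP[/andP[m3 n1] n2]].
  by rewrite z1 zk !mulr1 (cumulant_add_pt hphi _ a1).
rewrite [zeta_star _ _ _]ffunE; case: existsP => [[k1 /eqP ew]|_]; last first.
  by rewrite mulr0.
case: k1 ew => [k1|] ew; last first.
  move: m3 n1; rewrite ew tperm1 -/pp_one pp_mulu1 => /eqP[->].
  by rewrite eqxx.
have lw : pp_len w = 1%N by rewrite ew pp_len_tperm.
rewrite (shorter _ _ m3) ?mul0r ?lw //.
  by apply/eqP => w1; rewrite w1 pp_len1 in lw.
(* A further factorization with left factor from [add_pt] would be [p2], by injectivity of
   [split_pt]. *)
move=> u1 e1; case/eqP: n2; rewrite /p2 ew e1.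
move: m3; rewrite ew e1 pp_mul_add_pt_tperm ev => /eqP/Some_inj e2.
have eq1 : pp_perm u1 k1 = q.
  by apply: Some_inj; rewrite -(split_pt_permN _ u1) e2 split_pt_permN.
rewrite eq1 in e2; have eu := split_pt_inj e2.
by rewrite eu /t /k -eq1 eu permK.
Qed.

Lemma cumulant_one (T : finType) (a : T -> A) (u : partperm T) (p x : T) :
  a p = 1 -> x != p -> peq (pp_part u) p x -> free_cumulant phi a u = 0.
Proof.
move=> ap xp px.
pose f (z : option {y | y != p}) : T := if z is Some y then val y else p.
pose f' (z : T) : option {y | y != p} := insub z.
have fK : cancel f f'.
  by move=> [y|]; rewrite /f /f' ?valK // insubF // eqxx.
have f'K : cancel f' f.
  by move=> y; rewrite /f /f'; case: insubP => [z _ -> //|]; rewrite negbK => /eqP.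
have [u' pu' ->] := cumulant_bij hphi a u fK f'K.
by apply: (@cumulant_one_option _ (a \o f) u' (Sub x xp)); rewrite ?pu'.
Qed.

End UnitEntries.

(** * Cumulants of words in the generators *)

Section Words.
Variables (R : realType) (A : algType R[i]) (phi : seq A -> R[i]).
Hypothesis hphi : is_hops phi.
Variables (I : Type) (X : I -> classical_sets.set A).
Hypothesis freeX : free_of_all_orders phi X.

Definition word_prod (T : Type) (w : T -> seq A) (k : T) : A :=
  \prod_(y <- w k) y.

Lemma free_words_letters (T : finType) (c : T -> I) (w : T -> seq A)
    (s : {perm T}) :
  (forall k, {in w k, forall y, X (c k) y}) -> (exists p q, c p <> c q) ->
  (forall k, size (w k) = 1%N) ->
  free_cumulant phi (word_prod w) (pp_top s) = 0.
Proof.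
move=> wX [p [q pq]] w1.
have [u' pu' ->] := cumulant_bij hphi (word_prod w) (pp_top s)
   (@enum_valK T) (@enum_rankK T).
have -> : u' = pp_top (pp_perm u').
  apply: pp_ext => //; apply: peq_top_part => // x y.
  by rewrite pu' top_part_peq.
refine (@freeX #|T| (pp_perm u') (c \o @enum_val T T) (word_prod w \o @enum_val T T) _ _ _).
- have := cardD1 p T; have := cardD1 q (predD1 T p).
  rewrite !inE /=; have -> : q != p by apply/eqP => e; apply: pq; rewrite e.
  by rewrite ?inE => -> ->.
- move=> k; rewrite /= /word_prod; have := w1 (enum_val k); have := wX (enum_val k).
  case: (w (enum_val k)) => [|y [|]] //= h _; rewrite big_seq1.
  by apply: h; rewrite mem_head.
- by exists (enum_rank p), (enum_rank q); rewrite /= !enum_rankK.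
Qed.

(* If the blocks of [v] were monochromatic for [c1], then so would be the single
   block of the product, since the transposition joins [None] to a point that
   [v] maps to [q], whose colour is that of [None]. *)
Lemma split_pt_mixed (T : finType) (q : T) (c1 : option T -> I) (s : {perm T})
    (v w : partperm (option T)) k :
  c1 None = c1 (Some q) -> (exists x y, c1 (Some x) <> c1 (Some y)) ->
  pp_mul v w == Some (split_pt q (pp_top s)) ->
  w = pp_perm_only (tperm None k) ->
  exists x y, peq (pp_part v) x y /\ c1 x <> c1 y.
Proof.
move=> cN [x0 [y0 cxy]] /pp_mulP[e _] ew; apply: contrapT => nex.
have mono x y : peq (pp_part v) x y -> c1 x = c1 y.
  by move=> xy; apply: contrapT => nc; apply: nex; exists x, y.
(* [I] is an arbitrary type, while [pjoin_invariant] asks for decidable equality, so colours are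
   compared with that of [None] by a Boolean. *)
pose b z := `[< c1 z = c1 None >].
have vk : pp_perm v k = Some q.
  have := split_pt_permN q (pp_top s); rewrite -e pp_prod_perm ew permM.
  by rewrite -[pp_perm (pp_perm_only _)]/(tperm None k) tpermL.
have bk : b k = b None.
  by rewrite /b (mono k (Some q)) -?cN // -vk pp_peq.
have ball z : b z = b None.
  have : peq (pp_part (pp_prod v w)) z None by rewrite e split_pt_peq top_part_peq.
  apply: pjoin_invariant => // x y; first by move/mono; rewrite /b => ->.
  rewrite ew; apply: porbits_invariant => {x y} x.
  by case: tpermP => [->|->|].
have cz z : c1 z = c1 None.
  by apply/asboolP; rewrite -/(b z) ball; apply/asboolP.
by apply: cxy; rewrite !cz.
Qed.

Lemma free_words (T : finType) (c : T -> I) (w : T -> seq A) (s : {perm T}) :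
  (forall k, {in w k, forall y, X (c k) y}) -> (exists p q, c p <> c q) ->
  free_cumulant phi (word_prod w) (pp_top s) = 0.
Proof.
(* The measure counts the letters beyond the first of each word: it drops although the index set
   grows. The induction runs over all [T], since it continues on a block inside [option T]. *)
have [N] := ubnP (\sum_k (size (w k)).-1).
elim: N T c w s => // N IH T c w s leN wX mixed.
have [/existsP[p /eqP wp]|/existsPn wne] := boolP [exists p, w p == [::]].
  have [x xp] : exists x, x != p.
    case: mixed => [x [y cxy]]; have [exp|] := eqVneq x p; last by exists x.
    by exists y; apply/eqP => ey; apply: cxy; rewrite exp ey.
  apply: (cumulant_one hphi (p := p) _ xp); last exact: top_part_peq.
  by rewrite /word_prod wp big_nil.
have [/forallP w1|/forallPn[q wq]] := boolP [forall k, size (w k) == 1%N].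
  by apply: free_words_letters mixed _ => // k; apply/eqP.
case Ewq : (w q) wq => [|x w'] /=; first by have := wne q; rewrite Ewq.
rewrite eqSS -lt0n => w'0.
(* The first letter goes to [None], the left factor in the product formula, with the colour of
   [q]. *)
pose w1 (z : option T) := if z is Some k then if k == q then w' else w k
                          else [:: x].
pose c1 (z : option T) := if z is Some k then c k else c q.
have w1X k : {in w1 k, forall y, X (c1 k) y}.
  case: k => [k|] y /=; last by rewrite inE => /eqP->; apply: wX; rewrite Ewq mem_head.
  case: eqP => [->|_]; last exact: wX.
  by move=> yw; apply: wX; rewrite Ewq inE yw orbT.
have lt1 : (\sum_z (size (w1 z)).-1 < \sum_k (size (w k)).-1)%N.
  rewrite (bigD1 None) //= add0n (reindex_omap Some id) /=; last by case.
  rewrite (eq_bigl predT) => [|k]; last by rewrite eqxx.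
  rewrite (bigD1 q) //= [ltnRHS](bigD1 q) //= eqxx Ewq /=.
  rewrite [X in (_ + X < _)%N](eq_bigr (fun k => (size (w k)).-1)) => [|k /negPf->] //.
  by rewrite ltn_add2r; case: (size w') w'0.
rewrite (@cumulant_product _ _ _ hphi T q _ (word_prod w1)).
- rewrite ffunE big1 // => -[v t] /= vt; rewrite [zeta_star _ _ _]ffunE.
  case: existsP => [[k /eqP et]|_]; last by rewrite mulr0.
  have [|y [z [yz cyz]]] := @split_pt_mixed T q c1 s v t k erefl _ vt et.
    by case: mixed => y [z cyz]; exists y, z.
  have [s' [d ->]] := cumulant_block hphi (word_prod w1) v y.
  rewrite (IH _ (c1 \o val) (w1 \o val)) ?mul0r //.
  + apply: leq_ltn_trans (leq_trans lt1 leN).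
    rewrite -(big_sub (peq (pp_part v) y) (fun z => (size (w1 z)).-1)) /=.
    by rewrite [leqRHS](bigID (peq (pp_part v) y)) leq_addr.
  + by move=> k'; apply: w1X.
  + by exists (Sub y (peq_refl _ _)), (Sub z yz).
- by rewrite /word_prod /= eqxx Ewq big_cons big_seq1.
- by move=> k /negPf nk; rewrite /word_prod /= nk.
Qed.

End Words.

(** * The generated subalgebra as a span of words *)

Section GeneratedSubalgebra.
Variables (R : realType) (A : algType R[i]).

Definition monomials (X : classical_sets.set A) : classical_sets.set A :=
  fun y => exists2 w : seq A, {in w, forall z, X z} & y = \prod_(z <- w) z.

(** Linear combinations in list form: induction removes one element of [M] at a time, matching the
    shape of [cumulant_linear]. *)
Inductive lin_span (M : classical_sets.set A) : A -> Prop :=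
| LinSpan0 : lin_span M 0
| LinSpanD c x y : M x -> lin_span M y -> lin_span M (c *: x + y).

Lemma lin_span_linear M c x y :
  lin_span M x -> lin_span M y -> lin_span M (c *: x + y).
Proof.
move=> xM yM; elim: xM => [|d z x' zM _ IH]; first by rewrite scaler0 add0r.
by rewrite scalerDr scalerA -addrA; apply: LinSpanD.
Qed.

Lemma lin_span_mul M x y : (forall a b, M a -> M b -> M (a * b)) ->
  lin_span M x -> lin_span M y -> lin_span M (x * y).
Proof.
move=> MM xM yM; elim: xM => [|d z x' zM _ IH]; first by rewrite mul0r; left.
rewrite mulrDl -scalerAl; apply: lin_span_linear IH.
elim: yM => [|e t y' tM _ IH]; first by rewrite mulr0; left.
by rewrite mulrDr -scalerAr; apply: LinSpanD => //; apply: MM.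
Qed.

(** The empty word gives the unit and concatenation the product, so the span of the words is a
    unital subalgebra containing [X]. *)
Lemma gen_subalgebra_span X y :
  gen_subalgebra X y -> lin_span (monomials X) y.
Proof.
have incl z : monomials X z -> lin_span (monomials X) z.
  by move=> zM; rewrite -[z]addr0 -[z]scale1r; apply: LinSpanD => //; left.
apply: (@smallest_sub _ _ _ (lin_span (monomials X))) => [|z Xz].
  split.
  - by rewrite in_setE; apply: incl; exists [::]; rewrite ?big_nil.
  - by move=> c u v; rewrite !in_setE; apply: lin_span_linear.
  - move=> u v; rewrite !in_setE; apply: lin_span_mul.
    move=> _ _ [w1 h1 ->] [w2 h2 ->]; exists (w1 ++ w2); last by rewrite big_cat.
    by move=> z; rewrite mem_cat => /orP[/h1|/h2].
by apply: incl; exists [:: z]; rewrite ?big_seq1 // => t; rewrite inE => /eqP->.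
Qed.

Lemma sub_gen_subalgebra (X : classical_sets.set A) y : X y -> gen_subalgebra X y.
Proof. exact: sub_gen_smallest. Qed.

End GeneratedSubalgebra.

Lemma free_gen_subalgebra (R : realType) (A : algType R[i])
    (phi : seq A -> R[i]) (hphi : is_hops phi) (I : Type)
    (X : I -> classical_sets.set A) :
  free_of_all_orders phi X ->
  free_of_all_orders phi (fun i => gen_subalgebra (X i)).
Proof.
move=> freeX n s i a n2 aX mixed.
(* [D] holds the positions whose entry has not yet been expanded into words; the induction on its
   size expands one position at a time. *)
suff H (D : {set 'I_n}) (b : 'I_n -> A) :
    (forall k, k \in D -> lin_span (monomials (X (i k))) (b k)) ->
    (forall k, k \notin D -> monomials (X (i k)) (b k)) ->
    free_cumulant phi b (pp_top s) = 0.
  apply: (H setT) => k; last by rewrite inE.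
  move=> _; exact: gen_subalgebra_span (aX k).
have [m] := ubnP #|D|; elim: m D b => // m IH D b lem bD bM.
have [D0|/set0Pn[k kD]] := eqVneq D set0.
  have /choice[w wP] k : exists w : seq A,
      {in w, forall z, X (i k) z} /\ b k = \prod_(z <- w) z.
    by have [|w h e] := bM k; [rewrite D0 inE|exists w].
  have -> : b = word_prod w by apply: funext => k; apply: (wP k).2.
  by apply: (free_words hphi freeX (c := i)) => // k; apply: (wP k).1.
rewrite -(upd_id b k).
have updM y : monomials (X (i k)) y ->
    free_cumulant phi (upd b k y) (pp_top s) = 0.
  move=> yM; apply: (IH (D :\ k)).
  - by have := cardsD1 k D; rewrite kD; move: lem; clear; lia.
  - move=> j; rewrite !inE /upd => /andP[/negPf-> jD]; exact: bD.
  - move=> j; rewrite !inE /upd negb_and negbK; case: eqP => [->//|_] /= jD.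
    exact: bM.
(* Linearity with zero entries says that this value equals its own double. *)
have upd0 : free_cumulant phi (upd b k 0) (pp_top s) = 0.
  have := cumulant_linear hphi b k (pp_top s) 1 0 0.
  by rewrite scaler0 addr0 mul1r => /eqP; rewrite -subr_eq subrr eq_sym => /eqP.
elim: (bD k kD) => [//|c x y xM _ IHy].
by rewrite (cumulant_linear hphi) updM // IHy mulr0 addr0.
Qed.

Unset Implicit Arguments.

Theorem theorem7p12 (R : realType) (A : algType R[i]) (phi : seq A -> R[i])
    (hphi : is_hops phi) (I : Type) (X : I -> set A) :
  free_of_all_orders phi X <->
  free_of_all_orders phi (fun i => gen_subalgebra (X i)).
Proof.
split=> [|freeA n s i a n2 aX mixed]; first exact: free_gen_subalgebra.
by apply: (freeA n s i a n2 _ mixed) => k; apply: sub_gen_subalgebra.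
Qed.
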